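(* Let $R$ be a ring, let $D$ be a left $R$-module, and let $M$ be a strongly $\aleph_1$-presented left $R$-module such that $\operatorname{Ext}^n_R(M, D^{(\aleph_1)})=0$ for all $n\ge 1$. Then $M\in {}^\perp\overline{D}$, that is, $\operatorname{Ext}^1_R(M,B)=0$ for every $B\in\overline{D}$, where $\overline{D}$ is the definable closure of $D$.
   Context: Rings are associative with identity; modules are left modules. A module is $\aleph_1$-generated if it can be generated by at most $\aleph_1$ elements. A module is strongly $\aleph_1$-presented if it has a projective resolution consisting of $\aleph_1$-generated projective modules. $D^{(\aleph_1)}$ denotes the direct sum of $\aleph_1$ copies of $D$. A class of $R$-modules is definable if it is closed under direct products, direct limits (over directed sets) and pure submodules; the definable closure $\overline{D}$ of $D$ is the smallest definable class containing $D$. For a class $\mathcal{B}$ of modules, ${}^\perp\mathcal{B}=\{M\mid \operatorname{Ext}^1_R(M,B)=0 \text{ for all } B\in\mathcal{B}\}$. *)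

(* Defs.v *)
From HB Require Import structures.
From mathcomp Require Import all_boot all_order all_algebra.
From mathcomp Require Import all_classical.
From mathcomp Require wochoice.

Set Implicit Arguments.
Unset Strict Implicit.
Unset Printing Implicit Defensive.

Import GRing.Theory.
Local Open Scope classical_set_scope.
Local Open Scope card_scope.
Local Open Scope ring_scope.

(** * The cardinal aleph_1 *)

(* An arbitrary well-order of the continuum; [rle x y] is the non-strict
   relation. *)
Definition rle : rel (nat -> bool) :=
  sval (wochoice.well_ordering_principle (nat -> bool)).

(* The elements with countably many predecessors form the initial segment of
   order type omega_1, the first uncountable ordinal: it is uncountable
   ([uncountable_aleph1]) and embeds into every uncountable set
   ([aleph1_le]). *)
Definition aleph1 : Type :=
  {x : nat -> bool | `[< countable [set y | rle y x] >]}.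

Lemma rle_min (A : set (nat -> bool)) :
  A !=set0 -> exists2 z, A z & forall y, A y -> rle z y.
Proof.
move=> [a Aa].
have [|z [[zA zmin] _]] :=
  svalP (wochoice.well_ordering_principle (nat -> bool)) (mem A).
  by exists a; apply/mem_set.
exists z; first by apply/set_mem.
by move=> y Ay; apply: zmin; apply/mem_set.
Qed.

Lemma rle_refl x : rle x x.
Proof.
have [|z -> zx] := @rle_min [set x]; first by exists x.
by apply: zx.
Qed.

Lemma rle_anti x y : rle x y -> rle y x -> x = y.
Proof.
move=> xy yx.
have [|z [[zA zmin] zU]] :=
  svalP (wochoice.well_ordering_principle (nat -> bool)) (mem [set x; y]).
  by exists x; apply/mem_set; left.
have minP u : (u = x \/ u = y) -> wochoice.minimum_of rle (mem [set x; y]) u.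
  move=> uxy; split; first by apply/mem_set; case: uxy => ->; [left|right].
  by move=> v /set_mem[]->; case: uxy => ->; rewrite ?rle_refl.
by rewrite -(zU x) ?(zU y) //; apply: minP; [right|left].
Qed.

Lemma rle_total x y : rle x y \/ rle y x.
Proof.
have [|z zA zmin] := @rle_min [set x; y]; first by exists x; left.
by case: zA zmin => -> zmin; [left|right]; apply: zmin; [right|left].
Qed.

Lemma rle_trans x y z : rle x y -> rle y z -> rle x z.
Proof.
move=> xy yz.
have [|t tA tmin] := @rle_min [set u | u = x \/ u = y \/ u = z].
  by exists x; left.
case: tA => [|[]] tE; subst t.
- by apply: tmin; right; right.
- have yx : rle y x by apply: tmin; left.
  by rewrite (rle_anti xy yx).
- have zy : rle z y by apply: tmin; right; left.
  by rewrite -(rle_anti yz zy).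
Qed.

Lemma uncountable_cantor : ~ countable [set: nat -> bool].
Proof.
move=> /countable_injP[f finj].
pose g n := ~~ `[< exists2 b, f b = n & b n >].
have : g (f g) = ~~ g (f g).
  rewrite {1}/g; congr (~~ _); apply/asboolP/idP => [[b bg]|gg].
    by rewrite -(finj b g) ?inE.
  by exists g.
by case: (g _).
Qed.

Lemma uncountable_aleph1 : ~ countable [set: aleph1].
Proof.
move=> cW.
pose W := [set x | countable [set y | rle y x]].
have cW' : countable W.
  move/countable_injP: cW => [f finj]; apply/countable_injP.
  exists (fun x => if pselect (W x) is left Wx
                   then f (exist _ x (asboolT Wx)) else 0%N).
  move=> x y /set_mem Wx /set_mem Wy.
  case: pselect => // Wx'; case: pselect => // Wy' e.
  by have := finj _ _ (mem_set I) (mem_set I) e => -[].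
have [|z nWz zmin] := @rle_min (~` W).
  apply/set0P/negP => /eqP W0; apply: uncountable_cantor.
  by rewrite -(setCK W) W0 setC0 in cW'.
apply: nWz; rewrite /W/=.
apply: (@sub_countable _ _ _ (\bigcup_(b in [set: bool])
                                if b then W else [set z])).
  apply: subset_card_le => y /= yz.
  have [->|nyz] := pselect (y = z); first by exists false.
  exists true => //; apply: contrapT => /zmin zy; exact: nyz (rle_anti yz zy).
by apply: bigcup_countable => // -[] _; [|exact: countable1].
Qed.

Lemma inj_card_le_image (T U : Type) (A : set T) (B : set U) (f : T -> U) :
  {in A &, injective f} -> (forall x, A x -> B (f x)) -> A #<= B.
Proof.
move=> finj fAB; rewrite -(card_le_eql (inj_card_eq finj)).
by apply: subset_card_le => _ [x Ax <-]; exact: fAB.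
Qed.

Lemma aleph1_le (T : Type) (A : set T) :
  ~ countable A -> [set: aleph1] #<= A.
Proof.
move=> ncA.
pose lt (x y : aleph1) := rle (sval x) (sval y) /\ x <> y.
have sval_inj (x y : aleph1) : sval x = sval y -> x = y by exact: val_inj.
have wf : well_founded lt.
  move=> x; apply: contrapT => nax.
  have [|u [y <- nay] umin] := @rle_min [set u | exists2 y, sval y = u & ~ Acc lt y].
    by exists (sval x), x.
  apply: nay; constructor => t [ty nty]; apply: contrapT => nat_.
  by apply/nty/sval_inj/rle_anti => //; apply: umin; exists t.
have clt x : countable [set y | lt y x].
  have := asboolW (svalP x) => cx.
  apply: sub_countable cx; apply: (inj_card_le_image (f := sval)).
    by move=> y z _ _; exact: sval_inj.
  by move=> y [].
have [a0 Aa0] : A !=set0.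
  by apply/set0P/negP => /eqP A0; apply: ncA; rewrite A0; exact: countable0.
pose F x (rec : forall y, lt y x -> T) : T :=
  if pselect (exists a, A a /\ forall y (h : lt y x), rec y h <> a) is left e
  then sval (cid e) else a0.
pose f := Fix wf (fun=> T) F.
have fE x : f x = F x (fun y _ => f y).
  apply: Fix_eq => {}x g h gh; congr (F x _).
  by apply: functional_extensionality_dep => y; apply/funext => h'; exact: gh.
have fP x : A (f x) /\ forall y, lt y x -> f y <> f x.
  rewrite fE /F; case: pselect => [e|ne]; first exact: svalP (cid e).
  case: ne; apply: contrapT => nex; apply: ncA.
  apply: (@sub_countable _ _ _ [set f y | y in [set y | lt y x]]).
    apply: subset_card_le => a Aa; apply: contrapT => na; apply: nex.
    by exists a; split => // y yx fya; apply: na; exists y.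
  exact: sub_countable (card_image_le _ _) (clt x).
apply: (inj_card_le_image (f := f)); last by move=> x _; case: (fP x).
move=> x y _ _ fxy; apply: contrapT => nxy.
case: (rle_total (sval x) (sval y)) => h.
- by case: (fP y) => _ /(_ x); apply.
- by case: (fP x) => _ /(_ y); apply => //; split => // e; apply: nxy.
Qed.


(** * Modules *)

Section DirectSum.
Variables (R : pzRingType) (I : Type) (D : lmodType R).

Definition finsupp_pred : {pred (I -> D)} :=
  fun f => `[< finite_set [set i | f i <> 0] >].

Fact finsupp_submod_closed : submod_closed finsupp_pred.
Proof.
split=> [|a f g /asboolP ff /asboolP gf]; apply/asboolP.
  by apply: (sub_finite_set _ (@finite_set0 I)) => i /=; apply.
apply: (sub_finite_set _ (_ : finite_set ([set i | f i <> 0] `|` [set i | g i <> 0]))).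
  move=> i /= fgi; have [fi0|] := pselect (f i = 0); last by left.
  by right => gi0; apply: fgi; rewrite -[LHS]/(a *: f i + g i) fi0 gi0 scaler0 addr0.
by rewrite finite_setU.
Qed.

HB.instance Definition _ :=
  GRing.isSubmodClosed.Build R (I -> D) finsupp_pred finsupp_submod_closed.

(* The direct sum of copies of [D] indexed by [I], as the submodule of the
   finitely supported functions in the power [I -> D]. *)
Record direct_sum := DirectSum {
  dsum_val :> I -> D;
  dsum_valP : dsum_val \in finsupp_pred }.

HB.instance Definition _ := [isSub for dsum_val].
HB.instance Definition _ := [Choice of direct_sum by <:].
HB.instance Definition _ := [SubChoice_isSubLmodule of direct_sum by <:].

End DirectSum.

Section ModuleTheory.
Variable R : pzRingType.
Implicit Types M N P B : lmodType R.

Definition generates M (S : set M) : Prop :=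
  forall x : M, exists s : seq (R * M),
    (forall p, p \in s -> S p.2) /\ x = \sum_(p <- s) p.1 *: p.2.

Definition aleph1_generated M : Prop :=
  exists S : set M, S #<= [set: aleph1] /\ generates S.

Definition projective P : Prop :=
  forall (A B : lmodType R) (g : {linear A -> B}) (f : {linear P -> B}),
    (forall b, exists a, g a = b) ->
    exists h : {linear P -> A}, forall x, g (h x) = f x.

(* ... -> P_2 -> P_1 -> P_0 -> M -> 0, with [res_d n : P_(n+1) -> P_n]. *)
Record projective_resolution M := ProjectiveResolution {
  res_obj :> nat -> lmodType R;
  res_d : forall n, {linear res_obj n.+1 -> res_obj n};
  res_aug : {linear res_obj 0%N -> M};
  res_projective : forall n, projective (res_obj n);
  res_aug_surj : forall y, exists x, res_aug x = y;
  res_exact0 : forall x, res_aug x = 0 <-> exists y, res_d 0%N y = x;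
  res_exact : forall n x, res_d n x = 0 <-> exists y, res_d n.+1 y = x }.

Definition strongly_aleph1_presented M : Prop :=
  exists P : projective_resolution M, forall n, aleph1_generated (P n).

(* Cocycles and coboundaries of the cochain complex
   0 -> Hom(P_0, N) -> Hom(P_1, N) -> Hom(P_2, N) -> ... *)
Definition cocycle M (P : projective_resolution M) N n
    (f : {linear P n -> N}) : Prop :=
  forall x, f (res_d P n x) = 0.

Definition coboundary M (P : projective_resolution M) N n :
    {linear P n -> N} -> Prop :=
  match n with
  | 0%N => fun f => forall x, f x = 0
  | m.+1 => fun f => exists g : {linear P m -> N},
                       forall x, f x = g (res_d P m x)
  end.

(* Ext^n_R(M, N) = 0, i.e. H^n(Hom(P, N)) = 0 for the projective resolutions
   [P] of [M]. This cohomology does not depend on [P], up to isomorphism, and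
   every module has a projective resolution, so that quantifying over all [P]
   is the same as fixing one. *)
Definition Ext_eq0 n M N : Prop :=
  forall (P : projective_resolution M) (f : {linear P n -> N}),
    cocycle f -> coboundary f.

(* [L], with the maps [p i], is the direct product of the family [B]. *)
Definition is_direct_product (I : Type) (B : I -> lmodType R) (L : lmodType R)
    (p : forall i, {linear L -> B i}) : Prop :=
  forall x : (forall i, B i), exists! y : L, forall i, p i y = x i.

Record directed_system := DirectedSystem {
  ds_idx : Type;
  ds_le : ds_idx -> ds_idx -> Prop;
  ds_inhabited : inhabited ds_idx;
  ds_refl : forall i, ds_le i i;
  ds_trans : forall i j k, ds_le i j -> ds_le j k -> ds_le i k;
  ds_directed : forall i j, exists k, ds_le i k /\ ds_le j k;
  ds_obj :> ds_idx -> lmodType R;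
  ds_map : forall i j, ds_le i j -> {linear ds_obj i -> ds_obj j};
  ds_map_id : forall i (h : ds_le i i) x, ds_map h x = x;
  ds_map_comp : forall i j k (hij : ds_le i j) (hjk : ds_le j k)
                       (hik : ds_le i k) x,
    ds_map hjk (ds_map hij x) = ds_map hik x }.

Definition cocone (S : directed_system) (L : lmodType R)
    (g : forall i, {linear S i -> L}) : Prop :=
  forall i j (h : ds_le i j) (x : S i), g j (ds_map h x) = g i x.

(* [L], with the maps [g i], is the direct limit (colimit) of [S]. *)
Definition is_direct_limit (S : directed_system) (L : lmodType R)
    (g : forall i, {linear S i -> L}) : Prop :=
  cocone g /\
  forall (T : lmodType R) (h : forall i, {linear S i -> T}), cocone h ->
    (exists u : {linear L -> T}, forall i x, u (g i x) = h i x) /\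
    (forall u v : {linear L -> T},
       (forall i x, u (g i x) = h i x) -> (forall i x, v (g i x) = h i x) ->
       forall y, u y = v y).

(* Pure embeddings: a finite system of linear equations with constants in [N]
   that is solvable in [B] is solvable in [N]. *)
Definition pure_mono N B (e : {linear N -> B}) : Prop :=
  injective e /\
  forall (m n : nat) (a : 'M[R]_(m, n)) (c : 'I_m -> N),
    (exists y : 'I_n -> B, forall i, \sum_j a i j *: y j = e (c i)) ->
    exists x : 'I_n -> N, forall i, \sum_j a i j *: x j = c i.

(* Products and limits being given up to isomorphism, and isomorphisms being
   pure embeddings, such a class is closed under isomorphism. *)
Definition definable_class (C : lmodType R -> Prop) : Prop :=
  [/\ forall (I : Type) (B : I -> lmodType R) (L : lmodType R)
             (p : forall i, {linear L -> B i}),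
        is_direct_product p -> (forall i, C (B i)) -> C L,
      forall (S : directed_system) (L : lmodType R)
             (g : forall i, {linear S i -> L}),
        is_direct_limit g -> (forall i, C (S i)) -> C L
    & forall (N B : lmodType R) (e : {linear N -> B}),
        pure_mono e -> C B -> C N].

Definition definable_closure (D B : lmodType R) : Prop :=
  forall C : lmodType R -> Prop, definable_class C -> C D -> C B.

Definition left_perp (C : lmodType R -> Prop) (M : lmodType R) : Prop :=
  forall B : lmodType R, C B -> Ext_eq0 1 M B.

End ModuleTheory.

(* Main.v *)
Require Import Defs.
From HB Require Import structures.
From mathcomp Require Import all_boot all_order all_algebra.
From mathcomp Require Import all_classical.

Set Implicit Arguments.
Unset Strict Implicit.
Unset Printing Implicit Defensive.

Import GRing.Theory.
Local Open Scope classical_set_scope.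
Local Open Scope card_scope.
Local Open Scope ring_scope.

(* Let X be the first uncountable ordinal. Choosing X-indexed generators and
   dual bases, cochains with values in B become functions X -> B, acted on by
   row-finite matrices, and an initial segment of X closed under the supports
   of the rows is a countable subcomplex. Write U for D^N modulo D^(N).

   The hypothesis makes all higher cohomology vanish for D^(X), hence for
   (D^(X))^N and for W = (D^(X))^N / (D^(X))^(N). As W is countably saturated, a
   cocycle on a countable subcomplex with values in W is a coboundary as soon
   as it is one on every finite set of rows. So, if stationarily many closed
   segments carried a U-valued cocycle that does not extend, one could build a
   W-valued cocycle by transfinite recursion, putting the bad cocycle of the
   segment below b into the b-th coordinate; a global primitive of it would
   extend one of the bad cocycles. Hence U-valued cocycles extend from closed
   unboundedly many segments. Solvability modulo finite sequences of a
   countable system amounts to a stabilization property of finite systems; it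
   is expressed by implications between pp formulas, which pass from D to its
   definable closure. Therefore H^1 of closed segments vanishes on the closure,
   in particular on D^(X), so that the same argument with D^(X) in place of W
   extends D^(N)-valued cocycles. This yields stabilization, and so
   vanishing, for the relative complexes of pairs of closed segments, and a
   primitive of a B-valued cocycle is built segment by segment. *)

(** * Recursion along a well-founded relation with a choice at each stage *)

Lemma wf_dependent_choice (T B : Type) (lt : T -> T -> Prop) (b0 : B)
    (Phi : (T -> B) -> T -> Prop) :
  well_founded lt ->
  (forall x y z, lt x y -> lt y z -> lt x z) ->
  (forall f g x, (forall y, lt y x -> f y = g y) -> f x = g x ->
     Phi f x -> Phi g x) ->
  (forall f x, (forall y, lt y x -> Phi f y) ->
     exists2 g, (forall y, lt y x -> g y = f y) & Phi g x) ->
  exists f, forall x, Phi f x.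
Proof.
move=> wf lt_trans loc step.
(* A recursive call knows the values below [x] only, and [ext] completes them by [b0]. The value at
   [x] comes from a [g] agreeing with them below [x]; locality of [Phi] carries [Phi g x] over to
   [f]. *)
pose ext x (rec : forall y, lt y x -> B) y :=
  if pselect (lt y x) is left h then rec y h else b0.
pose P x rec (g : T -> B) := (forall y, lt y x -> g y = ext x rec y) /\ Phi g x.
pose F x rec : B := if pselect (exists g, P x rec g) is left e
  then sval (cid e) x else b0.
pose f := Fix wf (fun=> B) F.
have fE x : f x = F x (fun y _ => f y).
  apply: (Fix_eq wf (fun=> B) F) => {}x g h gh; congr (F x _).
  by apply: functional_extensionality_dep => y; apply/funext => h'; exact: gh.
have lt_irr x : ~ lt x x.
  by elim/(well_founded_ind wf): x => x IH xx; exact: (IH x xx xx).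
exists f; elim/(well_founded_ind wf) => x IH.
have extE y : lt y x -> ext x (fun y _ => f y) y = f y.
  by rewrite /ext; case: pselect.
have ex : exists g, P x (fun y _ => f y) g.
  have [g gf gx] := step f x IH.
  by exists g; split=> // y yx; rewrite extE // gf.
have := fE x; rewrite /F; case: pselect => // e; case: cid => g [gf gx] /= fx.
by apply: loc gx => // y yx; rewrite gf // extE.
Qed.

(** * The first uncountable ordinal *)

Definition olt (x y : aleph1) : Prop := rle (sval x) (sval y) /\ x <> y.

Lemma sval_aleph1_inj (x y : aleph1) : sval x = sval y -> x = y.
Proof. exact: val_inj. Qed.

Lemma olt_wf : well_founded olt.
Proof.
move=> x; apply: contrapT => nax.
have [|u [y <- nay] umin] := @rle_min [set u | exists2 y, sval y = u & ~ Acc olt y].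
  by exists (sval x), x.
apply: nay; constructor => t [ty nty]; apply: contrapT => nat_.
by apply/nty/sval_aleph1_inj/rle_anti => //; apply: umin; exists t.
Qed.

Lemma olt_irr x : ~ olt x x.
Proof. by case. Qed.

Lemma olt_trans x y z : olt x y -> olt y z -> olt x z.
Proof.
move=> [xy nxy] [yz nyz]; split; first exact: rle_trans xy yz.
by move=> xz; subst z; apply/nxy/sval_aleph1_inj/rle_anti.
Qed.

Lemma olt_total x y : olt x y \/ x = y \/ olt y x.
Proof.
have [->|nxy] := pselect (x = y); first by right; left.
case: (rle_total (sval x) (sval y)) => h; first by left.
by right; right; split=> // yx; apply: nxy.
Qed.

Lemma olt_asym x y : olt x y -> ~ olt y x.
Proof. by move=> xy yx; exact: olt_irr (olt_trans xy yx). Qed.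

Lemma olt_countable x : countable [set y | olt y x].
Proof.
have := asboolW (svalP x) => cx.
apply: sub_countable cx; apply: (inj_card_le_image (f := sval)).
  by move=> y z _ _; exact: sval_aleph1_inj.
by move=> y [].
Qed.

Definition ole x y := ~ olt y x.

Lemma oleP x y : ole x y <-> x = y \/ olt x y.
Proof.
split; last by case=> [->|xy yx]; [exact: olt_irr|exact: olt_asym xy yx].
by move=> nyx; case: (olt_total x y) => [|[]]; [right|left|].
Qed.

Lemma ole_lt_trans x y z : ole x y -> olt y z -> olt x z.
Proof. by move=> /oleP[->//|]; exact: olt_trans. Qed.

Lemma olt_le_trans x y z : olt x y -> ole y z -> olt x z.
Proof. by move=> xy /oleP[<-//|]; exact: olt_trans. Qed.

Lemma ole_refl x : ole x x. Proof. exact: olt_irr. Qed.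

Lemma olt_le x y : olt x y -> ole x y.
Proof. exact: olt_asym. Qed.

Lemma ole_trans x y z : ole x y -> ole y z -> ole x z.
Proof. by move=> xy yz zx; exact: yz (olt_le_trans zx xy). Qed.

Lemma ole_anti x y : ole x y -> ole y x -> x = y.
Proof. by move=> /oleP[//|xy] nxy; case: nxy. Qed.

Lemma omin (A : set aleph1) : A !=set0 -> exists2 x, A x & forall y, A y -> ole x y.
Proof.
move=> [a Aa]; apply: contrapT => nm; have : ~ A a; last by [].
elim/(well_founded_ind olt_wf): a {Aa} => a IH Aa.
by apply: nm; exists a => // y Ay ya; exact: (IH y ya Ay).
Qed.

(** Otherwise the uncountable [aleph1] would be a countable union of countable closed initial
    segments. *)
Lemma obounded (A : set aleph1) : countable A -> exists b, forall x, A x -> olt x b.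
Proof.
move=> cA; apply: contrapT => nb; apply: uncountable_aleph1.
apply: (@sub_countable _ _ _ (\bigcup_(a in A) (a |` [set y | olt y a]))).
  apply: subset_card_le => b _; apply: contrapT => nU; apply: nb; exists b.
  move=> a Aa; apply: contrapT => /oleP[ab|ba]; apply: nU; exists a => //=.
    by left.
  by right.
apply: bigcup_countable => // a _.
apply: (@sub_countable _ _ _ (\bigcup_(i in [set: bool])
          (if i then [set a] else [set y | olt y a]))).
  by apply: subset_card_le => y [->|ya]; [exists true|exists false].
by apply: bigcup_countable => // -[] _; [exact: countable1|exact: olt_countable].
Qed.

Lemma countable_range (T : Type) (u : nat -> T) : countable (range u).
Proof. exact: sub_countable (card_image_le _ _) (countableP _). Qed.

Lemma olt_range_bound (u : nat -> aleph1) : exists b, forall n, olt (u n) b.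
Proof.
have [b ub] := obounded (countable_range u).
by exists b => n; apply: ub; exists n.
Qed.

Lemma countable_enum (T : Type) (A : set T) : countable A -> A !=set0 ->
  exists u : nat -> T, forall x, A x -> exists n, u n = x.
Proof.
move=> /countable_injP[f finj] [a Aa].
exists (fun n => if pselect (exists2 x, A x & f x = n) is left e
                 then s2val (cid2 e) else a).
move=> x Ax; exists (f x); case: pselect => [e|[]]; last by exists x.
by case: cid2 => y Ay /= fyx; apply: finj; rewrite ?inE.
Qed.

Lemma aleph1_inhabited : aleph1.
Proof.
by have [b _] := cid (obounded (@countable0 aleph1)).
Qed.

(** The enumeration may leave the segment, as it must when the segment is empty; its uses test for
    membership. *)
Lemma olt_enum x : exists u : nat -> aleph1, forall y, olt y x -> exists n, u n = y.
Proof.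
have [e|ne] := pselect ([set y | olt y x] !=set0).
  exact: countable_enum (olt_countable x) e.
by exists (fun=> x) => y yx; case: ne; exists y.
Qed.

(** * Closed unbounded sets of closure points *)

(** The closure points form a closed unbounded set. A property of closed unboundedly many segments
    is stated as the existence of a [psi] all of whose closure points have it. *)
Definition oclosed (phi : aleph1 -> aleph1) b := forall x, olt x b -> olt (phi x) b.

Definition omax x y := if pselect (olt x y) then y else x.

Lemma omaxl x y : ole x (omax x y).
Proof. by rewrite /omax; case: pselect => // xy; [exact: olt_le|exact: ole_refl]. Qed.

Lemma omaxr x y : ole y (omax x y).
Proof. by rewrite /omax; case: pselect => // xy; exact: ole_refl. Qed.

Lemma oclosed_max phi psi b :
  oclosed (fun x => omax (phi x) (psi x)) b -> oclosed phi b /\ oclosed psi b.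
Proof.
move=> cl; split=> x xb; apply: ole_lt_trans (cl x xb).
  exact: omaxl.
exact: omaxr.
Qed.

(** The supremum is taken of an increasing sequence in which each term bounds the values of [phi]
    below its predecessor. *)
Lemma oclosed_unbounded phi a : exists2 b, olt a b & oclosed phi b.
Proof.
have next x : exists b, olt x b /\ forall y, olt y x -> olt (phi y) b.
  have [c cP] : exists c, forall y, (phi @` [set y | olt y x]) y -> olt y c.
    apply: obounded; exact: sub_countable (card_image_le _ _) (olt_countable x).
  have [b bP] := olt_range_bound (fun n => if n is 0%N then x else c).
  exists b; split; first exact: (bP 0%N).
  by move=> y yx; apply: olt_trans (bP 1%N); apply: cP; exists y.
pose nx x := sval (cid (next x)).
have nxP x : olt x (nx x) /\ forall y, olt y x -> olt (phi y) (nx x).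
  by rewrite /nx; case: cid.
pose u n := iter n nx a.
have [b0 b0P] := olt_range_bound u.
have [|b bP bmin] := omin (A := [set b | forall n, olt (u n) b]); first by exists b0.
exists b; first exact: (bP 0%N).
move=> x xb; have [n xn] : exists n, olt x (u n).
  apply: contrapT => nex; apply: (bmin x) => // n.
  apply: contrapT => /oleP xn; apply: nex; exists n.+1.
  by case: xn => [->|xn]; [|apply: olt_trans xn _]; case: (nxP (u n)).
by apply: olt_trans (bP n.+1); case: (nxP (u n)) => _; exact.
Qed.

(** A supremum of closure points is a closure point, so the supremum of those up to [y] is the
    largest of them. *)
Lemma oclosed_floor phi y : exists b, [/\ oclosed phi b, ole b y &
  forall c, oclosed phi c -> ole c y -> ole c b].
Proof.
have [|b bP bmin] := omin (A := [set b | forall c, oclosed phi c -> ole c y -> ole c b]).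
  by exists y.
have by_ : ole b y by apply: bmin.
exists b; split=> // x xb.
have [c [cc cy xc]] : exists c, [/\ oclosed phi c, ole c y & olt x c].
  apply: contrapT => nc; apply: (bmin x) => // c cc cy xc; apply: nc.
  by exists c.
by apply: olt_le_trans (cc _ xc) _; exact: bP.
Qed.

Definition ofloor phi y := sval (cid (oclosed_floor phi y)).

Lemma ofloorP phi y : [/\ oclosed phi (ofloor phi y), ole (ofloor phi y) y &
  forall c, oclosed phi c -> ole c y -> ole c (ofloor phi y)].
Proof. by rewrite /ofloor; case: cid. Qed.

Lemma onext_ex phi b : exists c, [/\ oclosed phi c, olt b c &
  forall d, oclosed phi d -> olt b d -> ole c d].
Proof.
have [c bc cc] := oclosed_unbounded phi b.
have [|d [cd bd] dmin] := omin (A := [set d | oclosed phi d /\ olt b d]).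
  by exists c.
by exists d; split=> // e ce be; apply: dmin.
Qed.

Definition onext phi b := sval (cid (onext_ex phi b)).

Lemma onextP phi b : [/\ oclosed phi (onext phi b), olt b (onext phi b) &
  forall d, oclosed phi d -> olt b d -> ole (onext phi b) d].
Proof. by rewrite /onext; case: cid. Qed.

Lemma olt_next_floor phi y : olt y (onext phi (ofloor phi y)).
Proof.
have [cf fy fmax] := ofloorP phi y.
have [cn bn nmin] := onextP phi (ofloor phi y).
by apply: contrapT => ny; apply: (fmax _ cn) bn.
Qed.

Lemma floor_between phi b y : oclosed phi b -> ole b y ->
  (forall c, oclosed phi c -> ole c y -> ole c b) -> ofloor phi y = b.
Proof.
move=> cb by_ bmax; have [cf fy fmax] := ofloorP phi y.
by apply: ole_anti; [apply: bmax|apply: fmax].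
Qed.

(** [G c] continues the function from [c] to the next closure point, and [cur G] glues the pieces.
    Limit stages cost nothing, as [Phi] is tested at single points and depends only on a segment up
    to a closure point above. *)
Lemma transfinite_extension (B : Type) phi (Phi : (aleph1 -> B) -> aleph1 -> Prop) :
  (forall b f g, oclosed phi b -> (forall x, olt x b -> f x = g x) ->
     (forall y, olt y b -> Phi f y) -> forall y, olt y b -> Phi g y) ->
  (forall b c f, oclosed phi b -> oclosed phi c -> olt b c ->
     (forall y, olt y b -> Phi f y) ->
     exists2 g, (forall x, olt x b -> g x = f x) & forall y, olt y c -> Phi g y) ->
  forall b f, oclosed phi b -> (forall y, olt y b -> Phi f y) ->
  exists2 g, (forall x, olt x b -> g x = f x) & forall y, Phi g y.
Proof.
move=> loc step b f cb fb.
pose cur (G : aleph1 -> aleph1 -> B) x :=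
  if pselect (olt x b) then f x else G (ofloor phi x) x.
pose Psi (G : aleph1 -> aleph1 -> B) c := oclosed phi c -> ole b c ->
  (forall x, olt x c -> G c x = cur G x) /\ forall y, olt y (onext phi c) -> Phi (G c) y.
have cur_lt G x : olt x b -> cur G x = f x by rewrite /cur; case: pselect.
have cur_ge G x : ole b x -> cur G x = G (ofloor phi x) x.
  by rewrite /cur; case: pselect.
have floor_lt x c : olt x c -> olt (ofloor phi x) c.
  by move=> xc; have [_ fx _] := ofloorP phi x; exact: ole_lt_trans xc.
have cur_good G c : oclosed phi c -> ole b c ->
    (forall d, olt d c -> Psi G d) -> forall y, olt y c -> Phi (cur G) y.
  move=> cc bc Gc y yc; have [yb|by_] := pselect (olt y b).
    by apply: (loc b f) yb => // x xb; rewrite cur_lt.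
  have [cf fy fmax] := ofloorP phi y; set d := ofloor phi y in cf fy fmax.
  have bd : ole b d by apply: fmax.
  have dc : olt d c by exact: ole_lt_trans yc.
  have [Gd1 Gd2] := Gc d dc cf bd.
  have [cn dn nmin] := onextP phi d.
  have yn : olt y (onext phi d) by exact: olt_next_floor.
  apply: (loc (onext phi d) (G d)) yn => // x xn.
  have [xd|dx] := pselect (olt x d); first exact: Gd1.
  have bx : ole b x by exact: ole_trans dx.
  rewrite cur_ge //; congr (G _ x); apply/esym/floor_between => // e ce ex de.
  by apply: (nmin e ce de); exact: ole_lt_trans xn.
have [||||G GP] := @wf_dependent_choice aleph1 (aleph1 -> B) olt f Psi.
- exact: olt_wf.
- exact: olt_trans.
- move=> G H c GH Gc GP cc bc; have [G1 G2] := GP cc bc.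
  rewrite -Gc; split=> // x xc; rewrite G1 // /cur; case: pselect => // nxb.
  by rewrite GH //; exact: floor_lt.
- move=> G c GP; have [[cc bc]|n] := pselect (oclosed phi c /\ ole b c); last first.
    by exists G => // cc bc; case: n.
  have [cn cln _] := onextP phi c.
  have [g gc gn] := step c (onext phi c) (cur G) cc cn cln (cur_good G c cc bc GP).
  have Hlt y : olt y c -> (if pselect (y = c) then g else G y) = G y.
    by move=> yc; case: pselect => // e; case: (@olt_irr c); rewrite -{1}e.
  exists (fun d => if pselect (d = c) then g else G d).
    by move=> y yc; apply: Hlt.
  move=> _ _; case: pselect => //= _; split=> // x xc.
  rewrite gc // /cur; case: pselect => // nxb.
  by rewrite Hlt //; exact: floor_lt.
exists (cur G) => [x xb|y]; first exact: cur_lt.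
have [c yc cc] := oclosed_unbounded phi (omax b y).
by apply: (cur_good G c) => //; [apply: olt_le|]; apply: ole_lt_trans yc;
  [exact: omaxl|exact: omaxr].
Qed.

(** Row [x] is a strictly increasing sequence above all earlier rows, which together have only
    countably many entries. *)
Lemma aleph1_nat_inj : exists j : aleph1 * nat -> aleph1, injective j.
Proof.
pose Psi (G : aleph1 -> nat -> aleph1) x :=
  injective (G x) /\ forall y, olt y x -> forall m n, G y m <> G x n.
have [||||G GP] := @wf_dependent_choice aleph1 (nat -> aleph1) olt
  (fun=> aleph1_inhabited) Psi.
- exact: olt_wf.
- exact: olt_trans.
- move=> G H x GH Gx [G1 G2]; split; rewrite -Gx // => y yx m n.
  by rewrite -GH //; exact: G2.
- move=> G x _.
  have [b bP] : exists b, forall z, (\bigcup_(y in [set y | olt y x]) range (G y)) z -> olt z b.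
    apply: obounded; apply: bigcup_countable; first exact: olt_countable.
    by move=> y _; exact: countable_range.
  pose s z := sval (cid (olt_range_bound (fun=> z))).
  have sP z : olt z (s z) := svalP (cid (olt_range_bound (fun=> z))) 0%N.
  have mono m n : (m < n)%N -> olt (iter m s b) (iter n s b).
    elim: n => // n IH; rewrite ltnS leq_eqVlt => /predU1P[->|/IH mn]; first exact: sP.
    by apply: olt_trans mn _; exact: sP.
  have bl n : ole b (iter n s b).
    by case: n => [|n]; [exact: ole_refl|apply/olt_le/(mono 0%N)].
  exists (fun y => if pselect (y = x) then fun n => iter n s b else G y).
    by move=> y yx; case: pselect => // e; subst y; case: (olt_irr yx).
  rewrite /Psi; case: pselect => //= _; split.
    move=> m n mn; by case: (ltngtP m n) => // h; have := mono _ _ h; rewrite mn => /olt_irr.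
  move=> y yx m n; case: pselect => /= [yx'|_ e].
    by case: (@olt_irr x); rewrite -{1}yx'.
  by apply: (bl n); rewrite -e; apply: bP; exists y => //; exists m.
exists (fun p => G p.1 p.2) => -[x m] [y n] /= e.
case: (olt_total x y) => [xy|[xy|yx]].
- by case: (GP y) => _ /(_ x xy m n).
- by subst y; case: (GP x) => /(_ _ _ e) -> _.
- by case: (GP x) => _ /(_ y yx n m) h; case: h.
Qed.

(** * Linear forms with finitely many coefficients *)

Section Evaluation.
Variables (R : pzRingType) (X : choiceType).
Implicit Types (B : lmodType R) (r : seq (R * X)).

(** A row is a list of coefficients with their variables, repetitions allowed, so it makes sense in
    every module. A family of rows is a row-finite matrix, and nested evaluations are matrix
    products. *)
Definition ev B r (f : X -> B) : B := \sum_(p <- r) p.1 *: f p.2.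

Definition vars r : seq X := [seq p.2 | p <- r].

Lemma ev_nil B (f : X -> B) : ev [::] f = 0.
Proof. by rewrite /ev big_nil. Qed.

Lemma eq_ev B r (f g : X -> B) :
  (forall x, x \in vars r -> f x = g x) -> ev r f = ev r g.
Proof.
move=> fg; rewrite /ev [LHS]big_seq_cond [RHS]big_seq_cond.
by apply: eq_bigr => p /andP[pr _]; rewrite fg //; apply: map_f.
Qed.

Lemma evD B r (f g : X -> B) : ev r (fun x => f x + g x) = ev r f + ev r g.
Proof. by rewrite /ev -big_split; apply: eq_bigr => p _; rewrite scalerDr. Qed.

Lemma evN B r (f : X -> B) : ev r (fun x => - f x) = - ev r f.
Proof. by rewrite /ev -sumrN; apply: eq_bigr => p _; rewrite scalerN. Qed.

Lemma evB B r (f g : X -> B) : ev r (fun x => f x - g x) = ev r f - ev r g.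
Proof. by rewrite evD evN. Qed.

Lemma ev0 B r : ev r (fun=> 0 : B) = 0.
Proof. by rewrite /ev big1 // => p _; rewrite scaler0. Qed.

Lemma ev_eq0 B r (f : X -> B) : (forall x, x \in vars r -> f x = 0) -> ev r f = 0.
Proof. by move=> f0; rewrite -(ev0 B r); exact: eq_ev. Qed.

Lemma linear_ev B (C : lmodType R) (g : {linear B -> C}) r (f : X -> B) :
  g (ev r f) = ev r (fun x => g (f x)).
Proof. by rewrite /ev linear_sum; apply: eq_bigr => p _; rewrite linearZ. Qed.

Lemma ev_fun (I : Type) B r (f : X -> I -> B) i : ev r f i = ev r (fun x => f x i).
Proof. by rewrite /ev fct_sumE. Qed.

Definition submod_pred B (P : B -> Prop) :=
  P 0 /\ forall (a : R) x y, P x -> P y -> P (a *: x + y).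

Lemma submod_predD B (P : B -> Prop) x y : submod_pred P -> P x -> P y -> P (x + y).
Proof. by move=> [_ PD] Px Py; rewrite -[x]scale1r; exact: PD. Qed.

Lemma submod_predN B (P : B -> Prop) x : submod_pred P -> P x -> P (- x).
Proof. by move=> [P0 PD] Px; rewrite -[- x]addr0 -scaleN1r; exact: PD. Qed.

Lemma submod_predB B (P : B -> Prop) x y : submod_pred P -> P x -> P y -> P (x - y).
Proof. by move=> sP Px Py; apply: submod_predD => //; exact: submod_predN. Qed.

Lemma submod_ev B (P : B -> Prop) r (f : X -> B) : submod_pred P ->
  (forall x, x \in vars r -> P (f x)) -> P (ev r f).
Proof.
move=> [P0 PD] Pf; rewrite /ev big_seq; elim/big_ind: _ => //.
  by move=> x y Px Py; rewrite -[x]scale1r; exact: PD.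
by move=> p pr; rewrite -[_ *: _]addr0; apply: PD => //; apply/Pf/map_f.
Qed.

Lemma ev_filter B (P : pred X) r (f : X -> B) :
  ev [seq p <- r | P p.2] f = ev r (fun x => if P x then f x else 0).
Proof.
rewrite /ev big_filter big_mkcond; apply: eq_bigr => p _.
by case: (P p.2) => //; rewrite scaler0.
Qed.

End Evaluation.

Section FiniteSupport.
Variables (R : pzRingType) (D : lmodType R).

Definition evz (a : nat -> D) := exists K, forall k, (K <= k)%N -> a k = 0.

Lemma evz_submod : submod_pred evz.
Proof.
split=> [|c a b [K aK] [L bL]]; first by exists 0%N.
exists (maxn K L) => k; rewrite geq_max => /andP[Kk Lk].
by rewrite -[LHS]/(c *: a k + b k) aK // bL // scaler0 addr0.
Qed.

Lemma evz_list (X : choiceType) (f : X -> nat -> D) (xs : seq X) :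
  (forall x, x \in xs -> evz (f x)) ->
  exists K, forall x k, x \in xs -> (K <= k)%N -> f x k = 0.
Proof.
elim: xs => [|x xs IH] fz; first by exists 0%N.
have [|K KP] := IH; first by move=> y ys; apply: fz; rewrite inE ys orbT.
have [|L LP] := fz x; first by rewrite inE eqxx.
exists (maxn K L) => y k; rewrite inE geq_max => /predU1P[->|ys] /andP[Kk Lk].
  exact: LP.
exact: KP.
Qed.

Lemma evz_iter (f : nat -> nat -> D) n : (forall i, (i < n)%N -> evz (f i)) ->
  exists K, forall i k, (i < n)%N -> (K <= k)%N -> f i k = 0.
Proof.
move=> fz; have [|K KP] := @evz_list nat f (iota 0 n).
  by move=> i; rewrite mem_iota add0n => /andP[_]; exact: fz.
by exists K => i k ni; apply: KP; rewrite mem_iota.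
Qed.

End FiniteSupport.

(** * Positive primitive implications *)

Section PositivePrimitive.
Variable R : pzRingType.

(* The pp formula with free variables [vs]; the other variables of the system
   [rows] are existentially quantified. *)
Definition pp (V : choiceType) (B : lmodType R) (vs : seq V) (rows : seq (seq (R * V)))
    (f : V -> B) :=
  exists g : V -> B, (forall v, v \in vs -> g v = f v) /\
    (forall r, r \in rows -> ev r g = 0).

(** Membership in the definable closure enters the argument through this consequence. *)
Definition pp_closed (V : choiceType) (D B : lmodType R) :=
  forall vs rows1 rows2, (forall f : V -> D, pp vs rows1 f -> pp vs rows2 f) ->
  forall f : V -> B, pp vs rows1 f -> pp vs rows2 f.

Lemma pp_closed_refl (V : choiceType) (D : lmodType R) : pp_closed V D D.
Proof. by move=> vs rows1 rows2. Qed.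

Lemma dsum_ev (V : choiceType) (D : lmodType R) (I : Type) (r : seq (R * V))
    (h : V -> direct_sum I D) i : ev r h i = ev r (fun v => h v i).
Proof.
have /(congr1 (@^~ i)) := linear_ev (val : {linear direct_sum I D -> (I -> D)}) r h.
by rewrite ev_fun.
Qed.

(** Witnesses are chosen coordinatewise, and are zero wherever all free variables vanish; as there
    are finitely many free variables, the supports stay finite. *)
Lemma pp_closed_direct_sum (V : choiceType) (D : lmodType R) (I : Type) :
  pp_closed V D (direct_sum I D).
Proof.
move=> vs rows1 rows2 D12 f [g [gf gr]].
have /choice[h hP] i : exists h : V -> D, [/\ forall v, v \in vs -> h v = f v i,
    forall r, r \in rows2 -> ev r h = 0 &
    (forall v, v \in vs -> f v i = 0) -> forall v, h v = 0].
  have [f0|nf0] := pselect (forall v, v \in vs -> f v i = 0).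
    by exists (fun=> 0); split=> // [v vvs|r _]; [rewrite f0|rewrite ev0].
  have [|h [hf hr]] := D12 (fun v => f v i).
    exists (fun v => g v i); split=> [v vvs|r rr]; first by rewrite gf.
    by rewrite -dsum_ev gr.
  by exists h.
have hfin v : (fun i => h i v) \in @finsupp_pred R I D.
  apply/asboolP; have [e|] := pselect (finite_set [set i | exists2 v, v \in vs & f v i <> 0]).
    apply: sub_finite_set e => i /= hi; apply: contrapT => nv; apply: hi.
    have [_ _] := hP i; apply=> w wvs; apply: contrapT => nw; apply: nv.
    by exists w.
  case; elim: (vs) => [|w ws IH].
    by apply: (sub_finite_set _ (@finite_set0 I)) => i [].
  apply: (@sub_finite_set _ _ ([set i | f w i <> 0] `|`
    [set i | exists2 v, v \in ws & f v i <> 0])).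
    by move=> i /= [u]; rewrite inE => /predU1P[->|us] fu; [left|right; exists u].
  by rewrite finite_setU; split=> //; exact/asboolP/(dsum_valP (f w)).
exists (fun v => DirectSum (hfin v)); split=> [v vvs|r rr].
  by apply: val_inj; apply/funext => i /=; have [-> //] := hP i.
by apply: val_inj; apply/funext => i /=; rewrite dsum_ev /=; have [_ -> //] := hP i.
Qed.

End PositivePrimitive.

(** * Countable systems of equations *)

Section CountableSystem.
Variables (R : pzRingType) (X : choiceType).
Variables (L1 L2 Rh : nat -> seq (R * X)).

(** For the matrices [d 0], [d 1] and [e 1] of a resolution in place of [L1], [L2] and [Rh], this is
    the vanishing of the first cohomology; [Rh] then projects cochains of the free module onto those
    of its summand P_1. *)
Definition solvable (B : lmodType R) := forall b : X -> B,
  (forall i, ev (L2 i) b = 0) -> exists v : X -> B, forall i, ev (L1 i) v = ev (Rh i) b.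

Variable D : lmodType R.

Hypothesis solvable_fin : forall v : X -> nat -> D, (forall i, evz (ev (L1 i) v)) ->
  exists2 u : X -> nat -> D, (forall x, evz (u x)) & forall i, ev (L1 i) u = ev (L1 i) v.
Hypothesis solvable_mod_fin : forall b : X -> nat -> D, (forall i, evz (ev (L2 i) b)) ->
  exists v : X -> nat -> D, forall i, evz (ev (L1 i) v - ev (Rh i) b).

(* Counterexamples for all [k] form the coordinates of a sequence to which
   [solvable_fin] applies, and so contradict each other; [pro_zero] is obtained
   in the same way from [solvable_mod_fin]. *)
Lemma stationary (xs : seq X) : exists k, forall m, forall v : X -> D,
  (forall i, (i < k)%N -> ev (L1 i) v = 0) ->
  exists2 w, (forall x, x \in xs -> w x = v x) & forall i, (i < m)%N -> ev (L1 i) w = 0.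
Proof.
apply: contrapT => nst.
have /choice[vm vmP] k : exists vm : (X -> D) * nat,
    (forall i, (i < k)%N -> ev (L1 i) vm.1 = 0) /\
    ~ exists2 w, (forall x, x \in xs -> w x = vm.1 x) &
        forall i, (i < vm.2)%N -> ev (L1 i) w = 0.
  apply: contrapT => nk; apply: nst; exists k => m v v0; apply: contrapT => nw.
  by apply: nk; exists (v, m).
have [|u uz uv] := @solvable_fin (fun x k => (vm k).1 x).
  move=> i; exists i.+1 => k ik; rewrite ev_fun; have [-> //] := vmP k.
have [|K KP] := @evz_list R D X u xs; first by move=> x _.
have [_] := vmP K; apply; exists (fun x => (vm K).1 x - u x K) => [x xxs|i _].
  by rewrite KP // subr0.
by rewrite evB; have /(congr1 (@^~ K)) := uv i; rewrite !ev_fun => ->; rewrite subrr.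
Qed.

Lemma pro_zero k : exists m, forall b : X -> D, (forall i, (i < m)%N -> ev (L2 i) b = 0) ->
  exists v : X -> D, forall i, (i < k)%N -> ev (L1 i) v = ev (Rh i) b.
Proof.
apply: contrapT => nst.
have /choice[b bP] m : exists b : X -> D, (forall i, (i < m)%N -> ev (L2 i) b = 0) /\
    ~ exists v : X -> D, forall i, (i < k)%N -> ev (L1 i) v = ev (Rh i) b.
  apply: contrapT => nb; apply: nst; exists m => b b0; apply: contrapT => nv.
  by apply: nb; exists b.
have [|v vP] := @solvable_mod_fin (fun x m => b m x).
  by move=> i; exists i.+1 => m im; rewrite ev_fun; have [-> //] := bP m.
have [|K KP] := @evz_iter R D (fun i => ev (L1 i) v - ev (Rh i) (fun x m => b m x)) k.
  by move=> i _.
have [_] := bP K; apply; exists (fun x => v x K) => i ik.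
apply/eqP; rewrite -subr_eq0; apply/eqP; rewrite -(KP i K ik) //.
by rewrite -[RHS]/(ev (L1 i) v K - ev (Rh i) (fun x m => b m x) K) !ev_fun.
Qed.

(** In [pro_zero_pp] the left copy of the variables carries [b] and the right copy the unknown [v];
    [stationary_pp] works in the left copy. *)
Let V := (X + X)%type.
Let lft (r : seq (R * X)) : seq (R * V) := [seq (p.1, inl p.2) | p <- r].
Let rgt (r : seq (R * X)) : seq (R * V) := [seq (p.1, inr p.2) | p <- r].

Let ev_lft (B : lmodType R) r (f : V -> B) : ev (lft r) f = ev r (fun x => f (inl x)).
Proof. by rewrite /ev big_map. Qed.

Let ev_rgt (B : lmodType R) r (f : V -> B) : ev (rgt r) f = ev r (fun x => f (inr x)).
Proof. by rewrite /ev big_map. Qed.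

Let ev_cat (B : lmodType R) r s (f : V -> B) : ev (r ++ s) f = ev r f + ev s f.
Proof. by rewrite /ev big_cat. Qed.

Let opp (r : seq (R * V)) := [seq (- p.1, p.2) | p <- r].

Let ev_opp (B : lmodType R) r (f : V -> B) : ev (opp r) f = - ev r f.
Proof.
by rewrite /ev big_map -sumrN; apply: eq_bigr => p _; rewrite /= scaleNr.
Qed.

Variable B : lmodType R.
Hypothesis ppDB : pp_closed V D B.

(** For each [m] this is an implication between pp formulas with free variables [xs]; the [k] found
    for [D] serves for [B]. *)
Lemma stationary_pp (xs : seq X) : exists k, forall m, forall v : X -> B,
  (forall i, (i < k)%N -> ev (L1 i) v = 0) ->
  exists2 w, (forall x, x \in xs -> w x = v x) & forall i, (i < m)%N -> ev (L1 i) w = 0.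
Proof.
have [k kP] := stationary xs; exists k => m v v0.
pose rows n := [seq lft (L1 i) | i <- iota 0 n].
pose vs : seq V := [seq inl x | x <- xs].
have rowsP n (C : lmodType R) (g : V -> C) :
    (forall r, r \in rows n -> ev r g = 0) <->
    forall i, (i < n)%N -> ev (L1 i) (fun x => g (inl x)) = 0.
  split=> [gr i ni|gr r /mapP[i]]; last first.
    by rewrite mem_iota => ni ->; rewrite ev_lft gr.
  by rewrite -ev_lft gr //; apply/mapP; exists i; rewrite ?mem_iota.
have [||g [gf /rowsP gr]] := @ppDB vs (rows k) (rows m) _ (fun z => if z is inl x then v x else 0).
- move=> f [g [gf /rowsP gr]]; have [w wg w0] := kP m _ gr.
  exists (fun z => if z is inl x then w x else 0); split; last exact/rowsP.
  by move=> _ /mapP[x xxs ->]; rewrite wg // gf //; exact: map_f.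
- by exists (fun z => if z is inl x then v x else 0); split=> //; apply/rowsP.
exists (fun x => g (inl x)) => // x xxs; rewrite gf //; exact: map_f.
Qed.

Lemma pro_zero_pp k : exists m, forall b : X -> B, (forall i, (i < m)%N -> ev (L2 i) b = 0) ->
  exists v : X -> B, forall i, (i < k)%N -> ev (L1 i) v = ev (Rh i) b.
Proof.
have [m mP] := pro_zero k; exists m => b b0.
pose vs : seq V := flatten [seq [seq inl x | x <- vars (Rh i)] | i <- iota 0 k].
pose rows1 := [seq lft (L2 i) | i <- iota 0 m].
pose rows2 := [seq rgt (L1 i) ++ opp (lft (Rh i)) | i <- iota 0 k].
have rows1P (C : lmodType R) (g : V -> C) : (forall r, r \in rows1 -> ev r g = 0) <->
    forall i, (i < m)%N -> ev (L2 i) (fun x => g (inl x)) = 0.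
  split=> [gr i ni|gr r /mapP[i]]; last first.
    by rewrite mem_iota => ni ->; rewrite ev_lft gr.
  by rewrite -ev_lft gr //; apply/mapP; exists i; rewrite ?mem_iota.
have rows2P (C : lmodType R) (g : V -> C) : (forall r, r \in rows2 -> ev r g = 0) <->
    forall i, (i < k)%N -> ev (L1 i) (fun x => g (inr x)) = ev (Rh i) (fun x => g (inl x)).
  split=> [gr i ni|gr r /mapP[i]].
    apply/eqP; rewrite -subr_eq0 -ev_lft -ev_rgt -ev_opp -ev_cat gr //.
    by apply/mapP; exists i => //; rewrite mem_iota.
  by rewrite mem_iota => ni ->; rewrite ev_cat ev_opp ev_lft ev_rgt gr // subrr.
have vsP i x : (i < k)%N -> x \in vars (Rh i) -> inl x \in vs.
  move=> ik xi; apply/flattenP; exists [seq inl x | x <- vars (Rh i)].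
    by apply/mapP; exists i; rewrite ?mem_iota.
  by apply/mapP; exists x.
pose fb (z : V) := if z is inl x then b x else 0.
have [||g [gf /rows2P gr]] := @ppDB vs rows1 rows2 _ fb.
- move=> f [g [gf /rows1P gr]]; have [v vP] := mP _ gr.
  exists (fun z => if z is inr x then v x else g z); split.
    by move=> z zvs; rewrite -gf //; case/flattenP: zvs => s /mapP[i _ ->] /mapP[x _ ->].
  exact/rows2P.
- by exists fb; split=> //; apply/rows1P.
exists (fun x => g (inr x)) => i ik; rewrite gr //.
by apply: eq_ev => x xi; rewrite gf //; exact: vsP xi.
Qed.

(** A Mittag-Leffler argument: the solutions [v k] of the first [k] equations are corrected, by
    stationarity, to a sequence [W] that no longer changes on [xs j] from stage [j] on. *)
Theorem solvable_pp : solvable B.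
Proof.
move=> b b0.
have /choice[v vP] k : exists v : X -> B, forall i, (i < k)%N -> ev (L1 i) v = ev (Rh i) b.
  by have [m] := pro_zero_pp k; apply=> i _.
pose xs j := flatten [seq vars (L1 i) | i <- iota 0 j].
have xsP i j x : (i < j)%N -> x \in vars (L1 i) -> x \in xs j.
  move=> ij xi; apply/flattenP; exists (vars (L1 i)) => //.
  by apply/mapP; exists i; rewrite ?mem_iota.
have xs_mono i j : (i <= j)%N -> {subset xs i <= xs j}.
  move=> ij x /flattenP[s /mapP[l]]; rewrite mem_iota => /andP[_ li] -> xl.
  by apply: xsP xl; apply: leq_trans ij.
have /choice[kk kkP] j := stationary_pp (xs j).
(* Including the first [kk j] equations lets stationarity be applied to the difference between [w]
   and a later approximation. *)
pose good j (w : X -> B) := forall i, (i < maxn j (kk j))%N -> ev (L1 i) w = ev (Rh i) b.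
have step j w : good j w -> exists2 w', good j.+1 w' & forall x, x \in xs j -> w' x = w x.
  move=> gw; pose n := maxn (maxn j (kk j)) (maxn j.+1 (kk j.+1)).
  have [|u uw u0] := kkP j n (fun x => v n x - w x).
    move=> i ik; have ij : (i < maxn j (kk j))%N by rewrite leq_max ik orbT.
    by rewrite evB gw // vP ?subrr // leq_max ij.
  (* On [xs j] the correction [u] equals [v n - w], so the values of [w] are kept; elsewhere [u]
     only adds a solution of the first [n] homogeneous equations. *)
  exists (fun x => v n x - u x) => [i ij|x xxs].
    have iN : (i < n)%N by rewrite leq_max ij orbT.
    by rewrite evB vP // u0 // subr0.
  by rewrite uw // opprB addrC subrK.
pose nx j w := if pselect (good j w) is left h then s2val (cid2 (step j w h)) else w.
have nxP j w : good j w -> good j.+1 (nx j w) /\ forall x, x \in xs j -> nx j w x = w x.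
  by rewrite /nx; case: pselect => // h _; case: cid2.
pose W := fix W j := if j is i.+1 then nx i (W i) else v (maxn 0 (kk 0)).
have Wg j : good j (W j).
  by elim: j => [|j IH] /=; [move=> i; exact: vP|case: (nxP j _ IH)].
have Wst i j x : (i <= j)%N -> x \in xs i -> W j x = W i x.
  move=> ij xi; elim: j ij => [|j IH]; first by rewrite leqn0 => /eqP->.
  rewrite leq_eqVlt => /predU1P[-> //|]; rewrite ltnS => ij /=.
  by have [_ ->] := nxP j _ (Wg j); [exact: IH|exact: xs_mono xi].
have [w wP] : exists w : X -> B, forall j x, x \in xs j -> w x = W j x.
  exists (fun x => if pselect (exists j, x \in xs j) is left e then W (sval (cid e)) x else 0).
  move=> j x xj; case: pselect => [e|[]]; last by exists j.
  case: cid => i xi /=; case/orP: (leq_total i j) => ij; first by rewrite (Wst i j).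
  by rewrite (Wst j i).
exists w => i; rewrite -(Wg i.+1) ?leq_max ?ltnSn //.
by apply: eq_ev => x xi; apply: wP; exact: xsP xi.
Qed.

End CountableSystem.

(** * Quotients and products of modules *)

Lemma quotient_module (R : pzRingType) (V : lmodType R) (P : V -> Prop) :
  submod_pred P ->
  exists (Q : lmodType R) (q : {linear V -> Q}), forall x, q x = 0 <-> P x.
Proof.
move=> sP; have [P0 PD] := sP.
pose rep (x : V) : V := choose (fun y => `[< P (x - y) >]) x.
have repP x : P (x - rep x).
  by apply/asboolP; apply: (chooseP (P := fun y => `[< P (x - y) >])); apply/asboolP; rewrite subrr.
have rep_eq x y : P (x - y) -> rep x = rep y.
  move=> Pxy; rewrite /rep.
  have e z : `[< P (x - z) >] = `[< P (y - z) >].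
    apply: asbool_equiv_eq; split=> h.
      have -> : y - z = (x - z) - (x - y) by rewrite opprB [RHS]addrC addrA subrK.
      exact: submod_predB.
    have -> : x - z = (x - y) + (y - z) by rewrite addrA subrK.
    exact: submod_predD.
  rewrite (eq_choose e); apply: choose_id; apply/asboolP; last by rewrite subrr.
  by rewrite -opprB; exact: submod_predN.
pose T := {x : V | rep x == x}.
have rep_id x : rep (rep x) == rep x.
  by apply/eqP/esym/rep_eq.
pose cl x : T := exist _ (rep x) (rep_id x).
have cl_eq x y : P (x - y) -> cl x = cl y by move=> h; apply: val_inj; exact: rep_eq.
have clK (t : T) : cl (val t) = t by apply: val_inj; apply/eqP; exact: (valP t).
have Pcl x : P (x - val (cl x)) by exact: repP.
have Pcl' x : P (val (cl x) - x) by rewrite -opprB; apply: submod_predN.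
have cl_add x y : cl (val (cl x) + y) = cl (x + y).
  by apply: cl_eq; rewrite opprD addrACA subrr addr0.
have cl_addr x y : cl (x + val (cl y)) = cl (x + y).
  by apply: cl_eq; rewrite opprD addrACA subrr add0r.
have cl_scale a x : cl (a *: val (cl x)) = cl (a *: x).
  by apply: cl_eq; rewrite -scalerBr -[_ *: _]addr0; apply: PD.
pose add (s t : T) := cl (val s + val t).
pose opp (s : T) := cl (- val s).
have addA : associative add.
  by move=> s t u; rewrite /add cl_addr cl_add addrA.
have addC : commutative add by move=> s t; rewrite /add addrC.
have add0 : left_id (cl 0) add by move=> s; rewrite /add cl_add add0r clK.
have addN : left_inverse (cl 0) opp add by move=> s; rewrite /add cl_add addNr.
pose zT : zmodType := HB.pack T (GRing.isZmodule.Build T addA addC add0 addN).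
pose sc (a : R) (s : zT) : zT := cl (a *: val s).
have scA a b s : sc a (sc b s) = sc (a * b) s by rewrite /sc cl_scale scalerA.
have sc1 : left_id 1 sc by move=> s; rewrite /sc scale1r clK.
have scDr : right_distributive sc +%R.
  by move=> a s t; rewrite /sc cl_scale scalerDr -cl_add -cl_addr.
have scDl s : {morph sc^~ s : a b / a + b}.
  by move=> a b; rewrite /sc scalerDl -cl_add -cl_addr.
pose Q : lmodType R := HB.pack zT (GRing.Zmodule_isLmodule.Build R zT scA sc1 scDr scDl).
have cl_lin : linear (cl : V -> Q).
  move=> a x y; rewrite -[RHS]/(cl (val (cl (a *: val (cl x))) + val (cl y))).
  by rewrite cl_add cl_addr -cl_add cl_scale cl_add.
pose lin := GRing.isLinear.Build R V Q *:%R (cl : V -> Q) cl_lin.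
pose q : {linear V -> Q} := HB.pack (cl : V -> Q) lin.
exists Q, q => x; split=> [|Px].
  move=> /(congr1 val) e; have {}e : rep x = rep 0 by exact: e.
  have -> : x = (x - rep x) + - (0 - rep 0) by rewrite e sub0r opprK subrK.
  by apply: submod_predD => //; apply: submod_predN => //.
by rewrite -[LHS]/(cl x) -[RHS]/(cl 0); apply: cl_eq; rewrite subr0.
Qed.

Lemma product_module (R : pzRingType) (I : Type) (B : I -> lmodType R) :
  exists (L : lmodType R) (p : forall i, {linear L -> B i}), is_direct_product p.
Proof.
pose T : choiceType := forall i, B i.
pose add (s t : T) : T := fun i => s i + t i.
pose opp (s : T) : T := fun i => - s i.
have ext (s t : T) : (forall i, s i = t i) -> s = t.
  by move=> st; apply: functional_extensionality_dep.
have addA : associative add by move=> s t u; apply: ext => i; exact: addrA.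
have addC : commutative add by move=> s t; apply: ext => i; exact: addrC.
have add0 : left_id (fun i => 0) add by move=> s; apply: ext => i; exact: add0r.
have addN : left_inverse (fun i => 0) opp add by move=> s; apply: ext => i; exact: addNr.
pose zT : zmodType := HB.pack T (GRing.isZmodule.Build T addA addC add0 addN).
pose sc (a : R) (s : zT) : zT := fun i => a *: (s : T) i.
have scA a b s : sc a (sc b s) = sc (a * b) s by apply: ext => i; exact: scalerA.
have sc1 : left_id 1 sc by move=> s; apply: ext => i; exact: scale1r.
have scDr : right_distributive sc +%R by move=> a s t; apply: ext => i; exact: scalerDr.
have scDl s : {morph sc^~ s : a b / a + b} by move=> a b; apply: ext => i; exact: scalerDl.
pose L : lmodType R := HB.pack zT (GRing.Zmodule_isLmodule.Build R zT scA sc1 scDr scDl).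
have pr_lin i : linear ((fun s : L => (s : T) i) : L -> B i) by [].
pose p i : {linear L -> B i} := HB.pack ((fun s : L => (s : T) i) : L -> B i)
  (GRing.isLinear.Build R L (B i) *:%R (fun s : L => (s : T) i) (pr_lin i)).
exists L, p => x; exists x; split=> // y yx; apply: ext => i; exact/esym/yx.
Qed.

Lemma direct_product_inj (R : pzRingType) (I : Type) (B : I -> lmodType R)
    (L : lmodType R) (p : forall i, {linear L -> B i}) :
  is_direct_product p -> forall x y, (forall i, p i x = p i y) -> x = y.
Proof.
move=> pP x y xy; have [z [zx zU]] := pP (fun i => p i y).
by rewrite -(zU x) // -(zU y).
Qed.

Lemma direct_product_pair (R : pzRingType) (I : Type) (B : I -> lmodType R)
    (L C : lmodType R) (p : forall i, {linear L -> B i}) (f : forall i, {linear C -> B i}) :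
  is_direct_product p -> exists g : {linear C -> L}, forall i x, p i (g x) = f i x.
Proof.
move=> pP; have /choice[g gP] x : exists y, forall i, p i y = f i x.
  by have [y [yP _]] := pP (fun i => f i x); exists y.
have g_lin : linear g.
  move=> a x y; apply: (direct_product_inj pP) => i.
  by rewrite gP !linearP !gP.
pose l := GRing.isLinear.Build R C L *:%R g g_lin.
by exists (HB.pack g l : {linear C -> L}).
Qed.

Section DirectLimit.
Variables (R : pzRingType) (S : directed_system R) (L : lmodType R).
Variable (g : forall i, {linear S i -> L}).
Hypothesis gP : is_direct_limit g.

Lemma direct_limit_surj y : exists i x, g i x = y.
Proof.
have [gc gU] := gP; pose P y := exists i x, g i x = y.
have sP : submod_pred P.
  have [i0] := ds_inhabited S; split; first by exists i0, 0; rewrite linear0.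
  move=> a _ _ [i [x <-]] [j [z <-]]; have [k [ik jk]] := ds_directed i j.
  by exists k, (a *: ds_map ik x + ds_map jk z); rewrite linearP !gc.
have [Q [q qP]] := quotient_module sP.
have [|_ U] := gU Q (fun i => \0%R); first by move=> i j h x.
apply/qP; apply: (U q \0%R) => // i x; apply/qP; by exists i, x.
Qed.

(** A cocone that detects vanishing: an element of [S j] goes to the family of its images in the
    later modules, in the product modulo the families that vanish from some index on. By
    universality it factors through [L]. *)
Lemma direct_limit_eq0 i x : g i x = 0 -> exists j (h : ds_le i j), ds_map h x = 0.
Proof.
move=> gx0; have [gc gU] := gP; have [T [p pP]] := product_module S.
pose P (t : T) := exists j0, forall j, ds_le j0 j -> p j t = 0.
have sP : submod_pred P.
  have [i0] := ds_inhabited S; split; first by exists i0 => j _; rewrite linear0.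
  move=> a s t [j jP] [k kP]; have [l [jl kl]] := ds_directed j k.
  exists l => m lm; rewrite linearP jP ?kP ?scaler0 ?addr0 //.
    exact: ds_trans kl lm.
  exact: ds_trans jl lm.
have [Q [q qP]] := quotient_module sP.
pose f j k : {linear S j -> S k} :=
  if pselect (ds_le j k) is left h then ds_map h else \0%R.
have fE j k (h : ds_le j k) z : f j k z = ds_map h z.
  by rewrite /f; case: pselect => // h'; rewrite (Prop_irrelevance h h').
pose e j := sval (cid (direct_product_pair (f j) pP)).
have eP j k z : p k (e j z) = f j k z by rewrite /e; case: cid.
pose h j : {linear S j -> Q} := q \o e j.
have [|[u uP] _] := gU Q h.
  move=> j k jk z; apply/eqP; rewrite -subr_eq0 /h /= -linearB; apply/eqP/qP.
  exists k => l kl; rewrite linearB !eP (fE _ _ kl) (fE _ _ (ds_trans jk kl)).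
  by rewrite (ds_map_comp jk kl (ds_trans jk kl)) subrr.
have := uP i x; rewrite gx0 linear0 => /esym/qP [j jP].
have [k [ik jk]] := ds_directed i j.
by exists k, ik; rewrite -fE -eP jP.
Qed.

Lemma direct_limit_lift (V : choiceType) (f : V -> L) (vs : seq V) :
  exists i (h : V -> S i), forall v, v \in vs -> g i (h v) = f v.
Proof.
have [gc _] := gP; elim: vs => [|w vs [i [h hP]]].
  by have [i0] := ds_inhabited S; exists i0, (fun=> 0).
have [j [x xw]] := direct_limit_surj (f w).
have [k [ik jk]] := ds_directed i j.
exists k, (fun v => if v == w then ds_map jk x else ds_map ik (h v)) => v.
rewrite inE; case: eqP => [-> _|_ /= vvs]; first by rewrite gc.
by rewrite gc hP.
Qed.

Lemma direct_limit_kill i (xs : seq (S i)) : (forall x, x \in xs -> g i x = 0) ->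
  exists j (h : ds_le i j), forall x, x \in xs -> ds_map h x = 0.
Proof.
elim: xs => [|y xs IH] x0; first by exists i, (ds_refl i).
have [|j [ij jP]] := IH; first by move=> x xxs; rewrite x0 // inE xxs orbT.
have [|k [ik kP]] := @direct_limit_eq0 i y; first by rewrite x0 // inE eqxx.
have [l [jl kl]] := ds_directed j k.
exists l, (ds_trans ij jl) => x; rewrite inE => /predU1P[->|xxs].
  by rewrite -(ds_map_comp ik kl) kP linear0.
by rewrite -(ds_map_comp ij jl) jP // linear0.
Qed.

End DirectLimit.

(** * Classes defined by positive primitive implications *)

Section Definable.
Variables (R : pzRingType) (V : choiceType).
Implicit Types D B C : lmodType R.

Lemma pp_map B (C : lmodType R) (g : {linear B -> C}) vs (rows : seq (seq (R * V))) f :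
  pp vs rows f -> pp vs rows (fun v => g (f v)).
Proof.
move=> [h [hf hr]]; exists (fun v => g (h v)); split=> [v vvs|r rr].
  by rewrite hf.
by rewrite -linear_ev hr // linear0.
Qed.

Lemma eq_pp B vs (rows : seq (seq (R * V))) (f f' : V -> B) :
  (forall v, v \in vs -> f v = f' v) -> pp vs rows f -> pp vs rows f'.
Proof. by move=> ff [g [gf gr]]; exists g; split=> // v vvs; rewrite gf ?ff. Qed.

(** The free variables, moved to the right-hand side, give the constants [c]; what remains is a
    finite matrix system in the variables [us], to which purity applies. *)
Lemma pp_pure B (C : lmodType R) (e : {linear B -> C}) vs (rows : seq (seq (R * V))) (f : V -> B) :
  pure_mono e -> pp vs rows (fun v => e (f v)) -> pp vs rows f.
Proof.
move=> [einj pe] [g [gf gr]].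
pose us := undup [seq v <- flatten [seq vars r | r <- rows] | v \notin vs].
have usP r v : r \in rows -> v \in vars r -> v \notin vs -> v \in us.
  move=> rr vr nv; rewrite mem_undup mem_filter nv; apply/flattenP.
  by exists (vars r) => //; apply: map_f.
have us_vs v : v \in us -> v \notin vs by rewrite mem_undup mem_filter => /andP[].
pose row i := nth [::] rows i.
pose A : 'M[R]_(size rows, size us) := \matrix_(i, j)
  \sum_(p <- row i | p.2 == tnth (in_tuple us) j) p.1.
pose c (i : 'I_(size rows)) := - ev [seq p <- row i | p.2 \in vs] f.
have split_ev (N : lmodType R) (h : V -> N) (i : 'I_(size rows)) :
    ev (row i) h = \sum_j A i j *: h (tnth (in_tuple us) j)
      + ev [seq p <- row i | p.2 \in vs] h.
  have ri : row i \in rows by exact: mem_nth.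
  have -> : \sum_j A i j *: h (tnth (in_tuple us) j) =
      \sum_(p <- row i | p.2 \notin vs) p.1 *: h p.2.
    under eq_bigr => j _ do rewrite mxE scaler_suml.
    rewrite (exchange_big_dep xpredT) //= [RHS]big_mkcond [LHS]big_seq [RHS]big_seq.
    apply: eq_bigr => p pr; case: ifPn => [nv|/negPn pv].
      have pus : p.2 \in us by apply: (usP (row i)) => //; exact: map_f.
      have iu : (index p.2 us < size us)%N by rewrite index_mem.
      have E j : (p.2 == tnth (in_tuple us) j) = (j == Ordinal iu).
        rewrite (tnth_nth p.2) /=; apply/eqP/eqP => [pj|-> /=]; last by rewrite nth_index.
        by apply: val_inj; rewrite /= pj index_uniq ?undup_uniq.
      under eq_bigl => j do rewrite E.
      by rewrite big_pred1_eq (tnth_nth p.2) /= nth_index.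
    rewrite big_pred0 // => j; apply/eqP => pj.
    by have := us_vs _ (mem_tnth j (in_tuple us)); rewrite -pj pv.
  by rewrite /ev big_filter [LHS](bigID (fun p => p.2 \in vs)) /= addrC.
have [|x xP] := pe _ _ A c.
  exists (fun j => g (tnth (in_tuple us) j)) => i.
  have := gr (row i) (mem_nth _ (ltn_ord i)); rewrite split_ev => /eqP.
  rewrite addr_eq0 => /eqP ->; rewrite /c linearN; congr (- _); rewrite linear_ev.
  apply: eq_ev => v /mapP[p]; rewrite mem_filter => /andP[pv _] ->; exact: gf.
pose h v := if v \in vs then f v else
  if insub (index v us) is Some j then x j else 0.
have hu j : h (tnth (in_tuple us) j) = x j.
  rewrite /h (negbTE (us_vs _ (mem_tnth j (in_tuple us)))).
  have -> : index (tnth (in_tuple us) j) us = j.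
    by rewrite (tnth_nth (tnth (in_tuple us) j)) /= index_uniq ?undup_uniq.
  by rewrite valK.
exists h; split=> [v vvs|r /(nthP [::])[i ri <-]]; first by rewrite /h vvs.
have := split_ev B h (Ordinal ri); rewrite /row /= => ->.
under eq_bigr do rewrite hu.
rewrite xP /c /= -[X in _ + X]opprK -opprD; apply/eqP; rewrite oppr_eq0 subr_eq0.
apply/eqP/eq_ev => v /mapP[p]; rewrite mem_filter => /andP[pv _] ->.
by rewrite /h pv.
Qed.

(** Products are treated coordinatewise. In a direct limit, a witness for [rows1] is lifted to one
    stage, and its finitely many equations become true at a later one. For pure submodules,
    [pp_pure] applies. *)
Lemma pp_closed_definable D : definable_class (pp_closed V D).
Proof.
split.
- move=> I B L p pP BC vs rows1 rows2 D12 f f1.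
  have ppi i : pp vs rows2 (fun v => p i (f v)) by apply: BC D12 _ _; exact: pp_map.
  pose G i := sval (cid (ppi i)).
  have GP i : (forall v, v \in vs -> G i v = p i (f v)) /\ forall r, r \in rows2 -> ev r (G i) = 0 by rewrite /G; case: cid.
  have /choice[g gP] v : exists y, forall i, p i y = G i v.
    by have [y [yP _]] := pP (fun i => G i v); exists y.
  exists g; split=> [v vvs|r rr]; apply: (direct_product_inj pP) => i.
    by rewrite gP; case: (GP i) => ->.
  rewrite linear_ev linear0; have [_ /(_ r rr) <-] := GP i.
  by apply: eq_ev => v _; exact: gP.
- move=> S L g gP SC vs rows1 rows2 D12 f [h [hf hr]].
  have [gc _] := gP.
  pose ws := vs ++ flatten [seq vars r | r <- rows1].
  have [i [k kP]] := direct_limit_lift gP h ws.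
  have [|j [ij jP]] := @direct_limit_kill _ _ _ _ gP i [seq ev r k | r <- rows1].
    move=> _ /mapP[r rr ->]; rewrite linear_ev -(hr r rr); apply: eq_ev => v vr.
    rewrite kP // mem_cat; apply/orP; right; apply/flattenP; exists (vars r) => //.
    exact: map_f.
  have : pp vs rows2 (fun v => ds_map ij (k v)).
    apply: SC D12 _ _; exists (fun v => ds_map ij (k v)); split=> // r rr.
    by rewrite -linear_ev jP //; exact: map_f.
  move=> /(pp_map (g j)); apply: eq_pp => v vvs.
  by rewrite gc kP ?hf // mem_cat vvs.
- move=> N B e pe BC vs rows1 rows2 D12 f f1.
  by apply: pp_pure pe _; apply: BC D12 _ _; exact: pp_map.
Qed.

Lemma definable_closure_pp D B : definable_closure D B -> pp_closed V D B.
Proof. by apply; [exact: pp_closed_definable|exact: pp_closed_refl]. Qed.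

End Definable.

(** * Extending cocycles from initial segments *)

Section ExtendCocycles.
Variables (R : pzRingType) (A : lmodType R).
Variables (d0 d1 e1 : aleph1 -> seq (R * aleph1)).
Hypothesis d1d0 : forall (B : lmodType R) (f : aleph1 -> B) z,
  ev (d1 z) (fun y => ev (d0 y) f) = 0.
Hypothesis e1d0 : forall (B : lmodType R) (f : aleph1 -> B) z,
  ev (e1 z) (fun y => ev (d0 y) f) = ev (d0 z) f.

Variable phi0 : aleph1 -> aleph1.
Hypothesis d0_phi : forall y x, x \in vars (d0 y) -> olt x (phi0 y).
Hypothesis d1_phi : forall y x, x \in vars (d1 y) -> olt x (phi0 y).
Hypothesis e1_phi : forall y x, x \in vars (e1 y) -> olt x (phi0 y).

Local Notation T := (aleph1 -> A).
Definition odelta (a : aleph1) (x : A) : T := fun b => if b == a then x else 0.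
Definition otrunc (b : aleph1) (t : T) : T :=
  fun a => if pselect (olt a b) then t a else 0.

(* [GT] and [GA] single out the admissible elements of [T] and [A], [NT] and
   [NA] those to be regarded as zero. *)
Variables (GT NT : T -> Prop) (GA NA : A -> Prop).
Hypotheses (GTs : submod_pred GT) (NTs : submod_pred NT).
Hypothesis GT_delta : forall a x, GA x -> GT (odelta a x).
Hypothesis NT_delta : forall a x, NA x -> NT (odelta a x).
Hypothesis GT_coord : forall a t, GT t -> GA (t a).
Hypothesis NT_coord : forall a t, NT t -> NA (t a).
Hypothesis GT_trunc : forall b t, GT t -> GT (otrunc b t).
Hypothesis NT_trunc : forall b t, NT t -> NT (otrunc b t).
Hypothesis GT_bounded : forall t, GT t -> exists b, forall a, ole b a -> t a = 0.
Hypothesis local_solvable : forall b (t : aleph1 -> T), oclosed phi0 b ->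
  (forall y, GT (t y)) ->
  (forall ys : seq aleph1, (forall y, y \in ys -> olt y b) ->
     exists2 s : aleph1 -> T, (forall x, GT (s x)) &
       forall y, y \in ys -> NT (ev (d0 y) s - t y)) ->
  exists2 s : aleph1 -> T, (forall x, GT (s x)) &
    forall y, olt y b -> NT (ev (d0 y) s - t y).
Hypothesis global_solvable : forall t : aleph1 -> T, (forall y, GT (t y)) ->
  (forall z, NT (ev (d1 z) t)) ->
  exists2 h : aleph1 -> T, (forall x, GT (h x)) &
    forall y, NT (ev (e1 y) t - ev (d0 y) h).

Let cocycle_below b (c : aleph1 -> A) :=
  (forall x, GA (c x)) /\ forall y, olt y b -> NA (ev (d0 y) c).

Let extends_to b (c : aleph1 -> A) g :=
  exists c' : aleph1 -> A, [/\ forall x, GA (c' x), forall x, olt x b -> c' x = c x &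
    forall y, olt y g -> NA (ev (d0 y) c')].

Let GA0 : GA 0.
Proof. by have [h _] := GTs; exact: (GT_coord aleph1_inhabited h). Qed.

Let NA0 : NA 0.
Proof. by have [h _] := NTs; exact: (NT_coord aleph1_inhabited h). Qed.

Lemma odelta_ev a r (c : aleph1 -> A) : ev r (fun x => odelta a (c x)) = odelta a (ev r c).
Proof.
apply/funext => b; rewrite ev_fun /odelta; case: eqP => // _.
by rewrite ev_eq0.
Qed.

Lemma otrunc_ev b r (s : aleph1 -> T) : ev r (fun x => otrunc b (s x)) = otrunc b (ev r s).
Proof.
apply/funext => a; rewrite ev_fun /otrunc; case: pselect => h; first by rewrite ev_fun.
by rewrite ev_eq0.
Qed.

(* A non-extendable cocycle [c b] on the segment below [b] is recorded in the
   [b]-th coordinate. The cocycle [t] below is cohomologous to zero on every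
   initial segment, but a global primitive of it would, at a closure point [b],
   give an extension of [c b]. *)
Lemma extend_cocycle_to : exists psi, forall b, oclosed phi0 b -> oclosed psi b ->
  forall c, cocycle_below b c -> forall g, extends_to b c g.
Proof.
(* If some cocycle below [b] fails to extend to some segment, such a pair is chosen; otherwise zero
   is a placeholder. *)
have /choice[cn cnP] b : exists cn : (aleph1 -> A) * aleph1, cocycle_below b cn.1 /\
    ((exists c g, cocycle_below b c /\ ~ extends_to b c g) -> ~ extends_to b cn.1 cn.2).
  have [[c [g [cb ng]]]|n] :=
    pselect (exists c g, cocycle_below b c /\ ~ extends_to b c g); first by exists (c, g).
  exists (fun=> 0, b); split=> //; split=> // y _; rewrite ev0; exact: NA0.
pose c b := (cn b).1; pose nu b := (cn b).2.
(* Closing under [nu] puts the target [nu b] below the next closure point after [b]. *)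
pose phi x := omax (phi0 x) (nu x).
pose splus b (s : aleph1 -> T) x : T :=
  if pselect (olt x b) then s x + odelta b (c b x) else 0.
(* Row [y] is the coboundary of the primitive [G b] at the floor [b] of [y], after adding [c b] in
   the new coordinate [b] and cutting off at [b]. *)
pose tG (G : aleph1 -> aleph1 -> T) y := ev (d0 y) (splus (ofloor phi y) (G (ofloor phi y))).
pose Psi (G : aleph1 -> aleph1 -> T) b := oclosed phi b ->
  [/\ forall x, GT (G b x), forall x a, ole b a -> G b x a = 0 &
      forall y, olt y b -> NT (ev (d0 y) (G b) - tG G y)].
have NT0 : NT 0 by case: NTs.
have GT0 : GT 0 by case: GTs.
have row0 b y x : oclosed phi b -> olt y b -> x \in vars (d0 y) -> olt x b.
  by move=> /oclosed_max[cb _] yb xy; apply: olt_trans (cb _ yb); exact: d0_phi.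
have floor_lt x b : olt x b -> olt (ofloor phi x) b.
  by move=> xb; have [_ fx _] := ofloorP phi x; exact: ole_lt_trans xb.
have GT_splus b s : (forall x, GT (s x)) -> forall x, GT (splus b s x).
  move=> sG x; rewrite /splus; case: pselect => //= _; apply: submod_predD => //.
  by apply: GT_delta; have [[h _] _] := cnP b; exact: h.
(* Below [b] the perturbation contributes only the coboundary of [c b], which is negligible there;
   from [b] to the next closure point the two sides agree by definition of [tG]. *)
have splus_ok G b : oclosed phi b -> Psi G b -> forall y, olt y (onext phi b) ->
    NT (ev (d0 y) (splus b (G b)) - tG G y).
  move=> cb Gb y yn; have [G1 G2 G3] := Gb cb.
  have [yb|by_] := pselect (olt y b).
    rewrite (_ : ev _ (splus _ _) = ev (d0 y) (G b) + odelta b (ev (d0 y) (c b))).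
      rewrite addrAC; apply: submod_predD => //; first exact: G3.
      by apply: NT_delta; have [[_ h] _] := cnP b; exact: h.
    rewrite -odelta_ev -evD; apply: eq_ev => x xy; rewrite /splus; case: pselect => //.
    by case; exact: row0 xy.
  have fb : ofloor phi y = b.
    have [cn_ bn nmin] := onextP phi b.
    by apply: floor_between => // e ce ey be; apply: (nmin e ce be); exact: ole_lt_trans yn.
  by rewrite /tG fb subrr.
have [||||G GP] := @wf_dependent_choice aleph1 (aleph1 -> T) olt (fun=> 0) Psi.
- exact: olt_wf.
- exact: olt_trans.
- move=> G H b GH Gb GP cb; have [G1 G2 G3] := GP cb.
  rewrite -Gb; split=> // y yb; rewrite /tG -GH; [exact: G3|exact: floor_lt].
- move=> G b GP; have [cb|ncb] := pselect (oclosed phi b); last by exists G.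
  have [cb0 _] := oclosed_max cb.
  have GTt y : olt y b -> GT (tG G y).
    move=> yb; apply: submod_ev => // x _; apply: GT_splus => {}x.
    have [cf _ _] := ofloorP phi y.
    by have [G1 _ _] := GP _ (floor_lt _ _ yb) cf.
  have suppt y a : olt y b -> ole b a -> tG G y a = 0.
    move=> yb ba; rewrite /tG ev_fun; apply: ev_eq0 => x _; rewrite /splus.
    case: pselect => //= xf; have [cf _ _] := ofloorP phi y.
    have fb := floor_lt _ _ yb.
    have [_ G2 _] := GP _ fb cf.
    rewrite -[LHS]/(G _ x a + odelta _ _ a) G2; last exact/olt_le/(olt_le_trans fb).
    rewrite add0r /odelta; case: eqP => // e; case: ba; by rewrite e.
  have [s [s1 s2 s3]] : exists s : aleph1 -> T, [/\ forall x, GT (s x),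
      forall x a, ole b a -> s x a = 0 & forall y, olt y b -> NT (ev (d0 y) s - tG G y)].
    (* If [b] is a limit of closure points, finitely many rows below [b] lie below an earlier
       closure point, whose primitive solves them, and [local_solvable] applies. Otherwise [b] is
       the successor of a closure point [g], and the perturbed primitive of [g] is taken. The least
       element falls under the first case, with no rows. *)
    have [lim|] := pselect (forall y, olt y b -> exists g, [/\ oclosed phi g, olt y g & olt g b]).
      pose t y := if pselect (olt y b) then tG G y else 0.
      have [||s s1 s3] := @local_solvable b t cb0.
      - by move=> y; rewrite /t; case: pselect => //= yb; exact: GTt.
      - move=> ys ysb.
        have [->|ys0] := eqVneq ys [::]; first by exists (fun=> 0).
        have [g [cg gb ysg]] : exists g, [/\ oclosed phi g, olt g b &
            forall y, y \in ys -> olt y g].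
          elim: ys ysb ys0 => // y ys IH ysb _.
          have [|g [cg yg gb]] := lim y; first by apply: ysb; rewrite inE eqxx.
          have [ys0|ys0] := eqVneq ys [::].
            by exists g; split=> // z; rewrite ys0 inE => /eqP->.
          have [|//|h [ch hb ysh]] := IH.
            by move=> z zys; apply: ysb; rewrite inE zys orbT.
          have [gh|hg] := pselect (olt g h).
            exists h; split=> // z; rewrite inE => /predU1P[->|]; last exact: ysh.
            exact: olt_trans gh.
          exists g; split=> // z; rewrite inE => /predU1P[->//|zys].
          by apply: olt_le_trans hg; exact: ysh.
        have [G1 _ G3] := GP g gb cg; exists (G g) => // y yys.
        by rewrite /t; case: pselect => [yb|[]]; [apply: G3; exact: ysg|exact: ysb].
      exists (fun x => otrunc b (s x)); split=> [x|x a ba|y yb]; first exact: GT_trunc.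
        by rewrite /otrunc; case: pselect.
      rewrite otrunc_ev (_ : _ - _ = otrunc b (ev (d0 y) s - t y)).
        exact/NT_trunc/s3.
      apply/funext => a; rewrite -[LHS]/(otrunc b _ a - tG G y a) /otrunc.
      case: pselect => ab; last by rewrite suppt // subr0.
      by rewrite -[RHS]/(ev (d0 y) s a - t y a) /t; case: pselect.
    move=> /existsNP[y /not_implyP[yb ny]].
    have [cf fy _] := ofloorP phi y; set g := ofloor phi y in cf fy.
    have gb : olt g b by exact: floor_lt.
    have [cg gn nmin] := onextP phi g.
    have nb : onext phi g = b.
      apply: ole_anti; first exact: nmin.
      move=> nb; apply: ny; exists (onext phi g); split=> //; exact: olt_next_floor.
    have Gg := GP g gb; have [G1 G2 G3] := Gg cf.
    exists (splus g (G g)); split=> [|x a ba|]; first exact: GT_splus.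
      have ga : olt g a by exact: olt_le_trans ba.
      rewrite /splus; case: pselect => //= _.
      rewrite -[LHS]/(G _ x a + odelta _ _ a) G2; last exact: olt_le.
      rewrite add0r /odelta; case: eqP => // e; case: (@olt_irr g); by rewrite -{2}e.
    by rewrite -nb; exact: splus_ok.
  have Hlt y : olt y b -> (if pselect (y = b) then s else G y) = G y.
    by move=> yb; case: pselect => //= e; case: (@olt_irr b); rewrite -{1}e.
  exists (fun y => if pselect (y = b) then s else G y) => // _.
  case: pselect => //= _; split=> // y yb.
  by rewrite /tG Hlt; [exact: s3|exact: floor_lt].
have GTt y : GT (tG G y).
  apply: submod_ev => // x _; apply: GT_splus => {}x.
  have [cf _ _] := ofloorP phi y; by have [G1 _ _] := GP _ cf.
have tP b y : oclosed phi b -> olt y b -> NT (ev (d0 y) (G b) - tG G y).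
  by move=> cb; have [_ _] := GP b cb; apply.
have rowsub r b y : oclosed phi b -> olt y b -> (forall x, x \in vars r -> olt x (phi0 y)) ->
    NT (ev r (fun y => ev (d0 y) (G b)) - ev r (tG G)).
  move=> cb yb rP; rewrite -evB; apply: submod_ev => // x /rP xy; apply: tP => //.
  by have [cb0 _] := oclosed_max cb; exact: olt_trans (cb0 _ yb).
have [|h hG hP] := @global_solvable (tG G) GTt.
  move=> z; have [b zb cb] := oclosed_unbounded phi z.
  rewrite -[ev _ _]opprK; apply: submod_predN => //.
  have := rowsub (d1 z) b z cb zb (@d1_phi z); by rewrite d1d0 sub0r.
(* Below a closure point, [tG G] agrees up to negligible terms with a coboundary, on which [e1] acts
   as the identity; so [h] is a primitive of [tG G] itself. *)
have htP y : NT (tG G y - ev (d0 y) h).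
  have [b yb cb] := oclosed_unbounded phi y.
  have := rowsub (e1 y) b y cb yb (@e1_phi y); rewrite e1d0 => N1.
  have -> : tG G y - ev (d0 y) h = (ev (e1 y) (tG G) - ev (d0 y) h)
      + ((ev (d0 y) (G b) - ev (e1 y) (tG G)) - (ev (d0 y) (G b) - tG G y)).
    by rewrite opprB [X in _ = _ + X]addrC subrKA [RHS]addrC subrKA.
  by apply: submod_predD => //; apply: submod_predB => //; exact: tP.
have /choice[bd bdP] x := GT_bounded (hG x).
exists (fun x => omax (phi x) (bd x)) => b cb0 /oclosed_max[cb cbd] c0 c0b g.
apply: contrapT => ng; have [cbP cn_bad] := cnP b; apply: cn_bad; first by exists c0, g.
(* At arguments below [b], the coordinate [b] of both [h] and [G b] is zero, which leaves [c b]. The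
   two terms are primitives of [tG G] up to the next closure point, which is beyond [nu b], so their
   difference is a cocycle there. *)
exists (fun x => splus b (G b) x b - h x b).
have [G1 G2 _] := GP b cb; split=> [x|x xb|y yn].
- rewrite -[_ - _]/((splus b (G b) x - h x) b); apply: GT_coord.
  by apply: submod_predB => //; exact: GT_splus.
- rewrite bdP ?subr0; last exact/olt_le/cbd.
  rewrite /splus; case: pselect => //= _.
  by rewrite -[LHS]/(G b x b + odelta _ _ b) G2 ?add0r /odelta ?eqxx //; exact: ole_refl.
- rewrite (_ : ev _ _ = (ev (d0 y) (splus b (G b)) - ev (d0 y) h) b); last first.
    by rewrite evB -!ev_fun.
  apply: NT_coord.
  have -> : ev (d0 y) (splus b (G b)) - ev (d0 y) h =
      (ev (d0 y) (splus b (G b)) - tG G y) + (tG G y - ev (d0 y) h) by rewrite addrA subrK.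
  apply: submod_predD => //; apply: splus_ok => //.
  apply: olt_trans yn _; have [/oclosed_max[_ cn_] bn _] := onextP phi b; exact: cn_.
Qed.

Theorem extend_cocycle : exists psi, forall b, oclosed psi b ->
  forall c : aleph1 -> A, (forall x, GA (c x)) ->
  (forall y, olt y b -> NA (ev (d0 y) c)) ->
  exists c' : aleph1 -> A, [/\ forall x, GA (c' x), forall x, olt x b -> c' x = c x &
    forall y, NA (ev (d0 y) c')].
Proof.
have [psi psiP] := extend_cocycle_to.
exists (fun x => omax (phi0 x) (psi x)) => b cb c cG cN.
pose Phi (f : aleph1 -> A) y := GA (f y) /\ NA (ev (d0 y) f).
have [|||c' c'b c'P] := @transfinite_extension A (fun x => omax (phi0 x) (psi x)) Phi _ _ b c cb.
- move=> b' f g /oclosed_max[cb' _] fg fP y yb; have [f1 f2] := fP y yb.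
  split; first by rewrite -fg.
  rewrite -(eq_ev (f := f)) // => x xy; apply: fg.
  by apply: olt_trans (cb' _ yb); exact: d0_phi.
- move=> b' g f /oclosed_max[cb0 cb1] cg bg fP.
  pose f1 x := if pselect (olt x b') then f x else 0.
  have [|f2 [f2G f2f f2P]] := psiP b' cb0 cb1 f1 _ g.
  + split=> [x|y yb].
      by rewrite /f1; case: pselect => //= xb; case: (fP x xb).
    have [_] := fP y yb; congr NA; apply: eq_ev => x xy; rewrite /f1; case: pselect => //.
    by case; apply: olt_trans (cb0 _ yb); exact: d0_phi.
  + by exists f2 => [x xb|y yg]; [rewrite f2f // /f1; case: pselect|split=> //; exact: f2P].
- by move=> y yb; split=> //; exact: cN.
by exists c'; split=> // x; case: (c'P x).
Qed.

End ExtendCocycles.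

(** * Finitely supported and row-finite matrices *)

Lemma finite_nat_bounded (A : set nat) : finite_set A ->
  exists K, forall k, A k -> (k < K)%N.
Proof.
move=> /finite_seqP[s ->]; exists (\max_(k <- s) k).+1 => k ks.
by rewrite ltnS; exact: leq_bigmax_seq.
Qed.

(** The index [j k] is the largest [i <= k] with [K i <= k], if there is one; it tends to
    infinity. *)
Lemma diagonal_index (K : nat -> nat) : exists j : nat -> nat, forall i,
  exists k0, forall k, (k0 <= k)%N -> (i <= j k)%N && (K (j k) <= k)%N.
Proof.
have /choice[j jP] k : exists j, forall i, (i <= k)%N -> (K i <= k)%N ->
    (i <= j)%N && (K j <= k)%N.
  pose P i := (i <= k)%N && (K i <= k)%N.
  have [e|ne] := pselect (exists i, P i); last first.
    by exists 0%N => i ik Ki; case: ne; exists i; rewrite /P ik.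
  have Pk i : P i -> (i <= k)%N by case/andP.
  case: (ex_maxnP e Pk) => j /andP[_ Kj] jmax; exists j => i ik Ki.
  by rewrite Kj andbT; apply: jmax; rewrite /P ik.
exists j => i; exists (maxn i (K i)) => k; rewrite geq_max => /andP[ik Ki].
exact: jP.
Qed.

Section Matrices.
Variables (R : pzRingType) (D : lmodType R).
Local Notation T := (aleph1 -> nat -> D).

(** With X for [aleph1], [colfin] describes (D^(X))^N and [matfin] its submodule (D^(X))^(N); the
    quotient is W. *)
Definition colfin (t : T) := forall k, finite_set [set a | t a k <> 0].
Definition matfin (t : T) := colfin t /\ exists K, forall a k, (K <= k)%N -> t a k = 0.

Lemma colfin_submod : submod_pred colfin.
Proof.
split=> [k|c s t sf tf k].
  by apply: (sub_finite_set _ (@finite_set0 _)) => a /=.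
apply: (sub_finite_set _ (_ : finite_set ([set a | s a k <> 0] `|` [set a | t a k <> 0]))).
  move=> a /= st; have [s0|] := pselect (s a k = 0); last by left.
  by right => t0; apply: st; rewrite -[LHS]/(c *: s a k + t a k) s0 t0 scaler0 addr0.
by rewrite finite_setU.
Qed.

Lemma matfin_submod : submod_pred matfin.
Proof.
have [c0 cD] := colfin_submod; split=> [|c s t [sc [K sK]] [tc [L tL]]].
  by split=> //; exists 0%N.
split; first exact: cD.
exists (maxn K L) => a k; rewrite geq_max => /andP[Kk Lk].
by rewrite -[LHS]/(c *: s a k + t a k) sK // tL // scaler0 addr0.
Qed.

Lemma matfinP t : matfin t <-> finite_set [set p : aleph1 * nat | t p.1 p.2 <> 0].
Proof.
split=> [[tc [K tK]]|tf].
  apply: (sub_finite_set _ (_ : finite_set (\bigcup_(k in `I_K)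
      ((fun a => (a, k)) @` [set a | t a k <> 0])))).
    move=> [a k] /= tak; exists k; last by exists a.
    by rewrite /= ltnNge; apply/negP => Kk; apply: tak; exact: tK.
  by apply: bigcup_finite => // k _; exact/finite_image/tc.
split=> [k|].
  apply: (sub_finite_set _ (finite_image fst tf)) => a /= tak.
  by exists (a, k).
have [K KP] := finite_nat_bounded (finite_image snd tf).
exists K => a k Kk; apply: contrapT => tak.
have kK : (k < K)%N by apply: KP; exists (a, k).
by rewrite ltnNge Kk in kK.
Qed.

Lemma colfin_delta a x : colfin (odelta a x).
Proof.
move=> k; apply: (sub_finite_set _ (finite_set1 a)) => b /=.
by rewrite /odelta; case: eqP.
Qed.

Lemma matfin_delta a x : evz x -> matfin (odelta a x).
Proof.
move=> [K xK]; split; first exact: colfin_delta.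
by exists K => b k Kk; rewrite /odelta; case: eqP => // _; rewrite xK.
Qed.

Lemma matfin_coord a t : matfin t -> evz (t a).
Proof. by move=> [_ [K tK]]; exists K => k; exact: tK. Qed.

Lemma colfin_trunc b t : colfin t -> colfin (otrunc b t).
Proof.
move=> tc k; apply: sub_finite_set (tc k) => a /=.
by rewrite /otrunc; case: pselect.
Qed.

Lemma matfin_trunc b t : matfin t -> matfin (otrunc b t).
Proof.
move=> [tc [K tK]]; split; first exact: colfin_trunc.
by exists K => a k Kk; rewrite /otrunc; case: pselect => //= _; exact: tK.
Qed.

Lemma colfin_bounded t : colfin t -> exists b, forall a, ole b a -> t a = 0.
Proof.
move=> tc.
have [|b bP] := @obounded (\bigcup_(k in [set: nat]) [set a | t a k <> 0]).
  by apply: bigcup_countable => // k _; exact: finite_set_countable.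
exists b => a ba; apply/funext => k; apply: contrapT => tak; apply: ba.
by apply: bP; exists k.
Qed.

(** A diagonal argument: column [k] is taken from a solution for the rows [ys (j k)], where [j]
    grows so slowly that the errors of that solution have ended by column [k]. *)
Lemma colfin_countably_saturated (d0 : aleph1 -> seq (R * aleph1)) b (t : aleph1 -> T) :
  (forall y, colfin (t y)) ->
  (forall ys : seq aleph1, (forall y, y \in ys -> olt y b) ->
     exists2 s : aleph1 -> T, (forall x, colfin (s x)) &
       forall y, y \in ys -> matfin (ev (d0 y) s - t y)) ->
  exists2 s : aleph1 -> T, (forall x, colfin (s x)) &
    forall y, olt y b -> matfin (ev (d0 y) s - t y).
Proof.
move=> tc loc; have [en enP] := olt_enum b.
pose ys j := [seq y <- [seq en i | i <- iota 0 j.+1] | `[< olt y b >]].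
have ysP i j : (i <= j)%N -> olt (en i) b -> en i \in ys j.
  move=> ij eb; rewrite mem_filter; apply/andP; split; first exact/asboolP.
  by apply/mapP; exists i; rewrite // mem_iota.
have /choice[sK sKP] j : exists sK : (aleph1 -> T) * nat, (forall x, colfin (sK.1 x)) /\
    forall y a k, y \in ys j -> (sK.2 <= k)%N -> (ev (d0 y) sK.1 - t y) a k = 0.
  have [|s sc sP] := loc (ys j).
    by move=> y; rewrite mem_filter => /andP[/asboolP].
  suff [K KP] : exists K, forall y a k, y \in ys j -> (K <= k)%N ->
      (ev (d0 y) s - t y) a k = 0 by exists (s, K).
  elim: (ys j) sP => [|y zs IH] sP; first by exists 0%N.
  have [|K KP] := IH; first by move=> z zzs; apply: sP; rewrite inE zzs orbT.
  have [|_ [L LP]] := sP y; first by rewrite inE eqxx.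
  exists (maxn K L) => z a k; rewrite inE geq_max => /predU1P[->|zzs] /andP[Kk Lk].
    exact: LP.
  exact: KP.
have [j jP] := diagonal_index (fun j => (sK j).2).
pose s x : T := fun a k => (sK (j k)).1 x a k.
have sc x : colfin (s x) by move=> k; have [h _] := sKP (j k); exact: (h x k).
exists s => // y yb; split.
  apply: (submod_predB colfin_submod) => //.
  by apply: (submod_ev colfin_submod) => x _.
have [i yi] := enP y yb; have [k0 k0P] := jP i.
exists k0 => a k /k0P /andP[ij Kk]; have [_ h] := sKP (j k).
rewrite -(h y a k) //; last by rewrite -yi; apply: ysP => //; rewrite yi.
by rewrite -[LHS]/(ev (d0 y) s a k - t y a k) -[RHS]/(ev _ _ a k - t y a k) !ev_fun.
Qed.

End Matrices.

(** * Vanishing on the definable closure *)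

Section Vanishing.
Variables (R : pzRingType) (D : lmodType R).
Variables (d e : nat -> aleph1 -> seq (R * aleph1)).
(* For a resolution by direct summands P_n of free modules F_n on [aleph1],
   [d n] is the matrix of F_(n+1) -> P_(n+1) -> P_n -> F_n and [e n] that of the
   idempotent F_n -> P_n -> F_n. *)
Hypothesis dd : forall n (B : lmodType R) (f : aleph1 -> B) z,
  ev (d n.+1 z) (fun y => ev (d n y) f) = 0.
Hypothesis ed : forall n (B : lmodType R) (f : aleph1 -> B) z,
  ev (e n.+1 z) (fun y => ev (d n y) f) = ev (d n z) f.
Hypothesis de : forall n (B : lmodType R) (f : aleph1 -> B) z,
  ev (d n z) (fun y => ev (e n y) f) = ev (d n z) f.
Hypothesis ee : forall n (B : lmodType R) (f : aleph1 -> B) z,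
  ev (e n z) (fun y => ev (e n y) f) = ev (e n z) f.
Hypothesis van : forall n (f : aleph1 -> direct_sum aleph1 D),
  (forall z, ev (d n.+1 z) f = 0) ->
  exists g : aleph1 -> direct_sum aleph1 D, forall y, ev (e n.+1 y) f = ev (d n y) g.

Local Notation T := (aleph1 -> nat -> D).

(** An injection of [aleph1 * nat] into [aleph1] turns finite matrices into elements of D^(X), with
    zeros outside its image; a primitive is read back along it. *)
Lemma van_matfin n (f : aleph1 -> T) : (forall x, matfin (f x)) ->
  (forall z, ev (d n.+1 z) f = 0) ->
  exists2 g : aleph1 -> T, (forall x, matfin (g x)) & forall y, ev (e n.+1 y) f = ev (d n y) g.
Proof.
move=> ff f0; have [j jinj] := aleph1_nat_inj.
pose val x c := if pselect (exists p, j p = c) is left h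
  then f x (sval (cid h)).1 (sval (cid h)).2 else 0.
have val_j x a k : val x (j (a, k)) = f x a k.
  rewrite /val; case: pselect => [h|[]]; last by exists (a, k).
  by case: cid => p /= /jinj ->.
have val_out x c : ~ (exists p, j p = c) -> val x c = 0.
  by rewrite /val; case: pselect.
have vfin x : val x \in @finsupp_pred R aleph1 D.
  apply/asboolP; have /matfinP fx := ff x.
  apply: (sub_finite_set _ (finite_image j fx)) => c /= vc.
  have [[[a k] jc]|n0] := pselect (exists p, j p = c); last by case: vc; exact: val_out.
  by exists (a, k); rewrite // -jc val_j in vc *.
pose F x := DirectSum (vfin x).
have [|G GP] := @van n F.
  move=> z; apply: val_inj; apply/funext => c /=; rewrite dsum_ev /=.
  have [[[a k] <-]|n0] := pselect (exists p, j p = c); last first.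
    by rewrite ev_eq0 // => x _; exact: val_out.
  rewrite (eq_ev (g := fun x => f x a k)); last by move=> x _; exact: val_j.
  by have := congr1 (fun t => t a k) (f0 z); rewrite !ev_fun.
exists (fun x a k => G x (j (a, k))) => [x|y].
  apply/matfinP; have /asboolP Gx := dsum_valP (G x).
  apply: (sub_finite_set _ (finite_preimage (f := j) _ Gx)); last by move=> p q _ _ /jinj.
  by move=> [a k].
apply/funext => a; apply/funext => k; rewrite !ev_fun.
rewrite -(dsum_ev (d n y) G) -GP dsum_ev.
by apply: eq_ev => x _; rewrite /= val_j.
Qed.

Lemma van_colfin n (f : aleph1 -> T) : (forall x, colfin (f x)) ->
  (forall z, ev (d n.+1 z) f = 0) ->
  exists2 g : aleph1 -> T, (forall x, colfin (g x)) & forall y, ev (e n.+1 y) f = ev (d n y) g.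
Proof.
move=> ff f0.
have ffin k x : (fun a => f x a k) \in @finsupp_pred R aleph1 D by apply/asboolP/ff.
have /choice[G GP] k : exists g : aleph1 -> direct_sum aleph1 D,
    forall y, ev (e n.+1 y) (fun x => DirectSum (ffin k x)) = ev (d n y) g.
  apply: van => z; apply: val_inj; apply/funext => a /=; rewrite dsum_ev /=.
  by have := congr1 (fun t => t a k) (f0 z); rewrite !ev_fun.
exists (fun x a k => G k x a) => [x k|y]; first exact/asboolP/(dsum_valP (G k x)).
apply/funext => a; apply/funext => k; rewrite !ev_fun.
by rewrite -(dsum_ev (d n y) (G k)) -GP dsum_ev.
Qed.

(** By the long exact sequence, the cohomology of W in degree n+1 lies between that of (D^(X))^N in
    degree n+1 and that of (D^(X))^(N) in degree n+2. Concretely, a finite [u] has the same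
    coboundary as [t], and [t - u] is a true cocycle. *)
Lemma van_mod_matfin n (t : aleph1 -> T) : (forall y, colfin (t y)) ->
  (forall z, matfin (ev (d n.+1 z) t)) ->
  exists2 h : aleph1 -> T, (forall x, colfin (h x)) &
    forall y, matfin (ev (e n.+1 y) t - ev (d n y) h).
Proof.
move=> tc dt; have [|u um uP] := @van_matfin n.+1 (fun z => ev (d n.+1 z) t) dt.
  by move=> z; rewrite dd.
have [||h hc hP] := @van_colfin n (fun y => t y - u y).
- by move=> y; apply: (submod_predB (@colfin_submod R D)) => //; case: (um y).
- by move=> z; rewrite evB -uP ed subrr.
exists h => // y; rewrite -hP evB opprB addrC subrK.
by apply: (submod_ev (@matfin_submod R D)) => x _.
Qed.

Lemma rows_bound : exists phi, forall n y x,
  x \in vars (d n y) ++ vars (e n y) -> olt x (phi y).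
Proof.
have /choice[phi phiP] y : exists b, forall n x,
    x \in vars (d n y) ++ vars (e n y) -> olt x b.
  have [|b bP] := @obounded (\bigcup_(n in [set: nat])
      [set x | x \in vars (d n y) ++ vars (e n y)]).
    by apply: bigcup_countable => // n _; exact/finite_set_countable/finite_seq.
  by exists b => n x xr; apply: bP; exists n.
by exists phi => n y x; exact: phiP.
Qed.

(** This is [extend_cocycle] for D^N modulo finite sequences: [local_solvable] is the countable
    saturation of W, and [global_solvable] the vanishing of its cohomology. *)
Lemma extend_mod_fin n : exists psi, forall b, oclosed psi b ->
  forall c : aleph1 -> nat -> D, (forall y, olt y b -> evz (ev (d n y) c)) ->
  exists2 c' : aleph1 -> nat -> D, (forall x, olt x b -> c' x = c x) &
    forall y, evz (ev (d n y) c').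
Proof.
have [phi phiP] := rows_bound.
have [||||||||||||psi psiP] := @extend_cocycle R (nat -> D) (d n) (d n.+1) (e n.+1)
  (@dd n) (@ed n) phi _ _ _ (@colfin R D) (@matfin R D) (fun=> True) (@evz R D)
  (@colfin_submod R D) (@matfin_submod R D).
- by move=> y x xy; apply: (phiP n); rewrite mem_cat xy.
- by move=> y x xy; apply: (phiP n.+1); rewrite mem_cat xy.
- by move=> y x xy; apply: (phiP n.+1); rewrite mem_cat xy orbT.
- by move=> a x _; exact: colfin_delta.
- exact: matfin_delta.
- by [].
- exact: matfin_coord.
- exact: colfin_trunc.
- exact: matfin_trunc.
- exact: colfin_bounded.
- by move=> b t _; exact: colfin_countably_saturated.
- exact: van_mod_matfin.
by exists psi => b cb c cN; have [|c' [_ h1 h2]] := psiP b cb c _ cN; [|exists c'].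
Qed.

(** * Cochains vanishing below [b], with equations below [g] *)

Section Relative.
Variables b g : aleph1.
Hypothesis relative_fin : forall v : aleph1 -> nat -> D,
  (forall x, olt x b -> v x = 0) -> (forall y, olt y g -> evz (ev (d 0 y) v)) ->
  exists u : aleph1 -> nat -> D, [/\ forall x, evz (u x), forall x, olt x b -> u x = 0 &
    forall y, olt y g -> ev (d 0 y) u = ev (d 0 y) v].
Hypothesis relative_mod_fin : forall c : aleph1 -> nat -> D,
  (forall x, olt x b -> c x = 0) -> (forall z, olt z g -> evz (ev (d 1 z) c)) ->
  exists v : aleph1 -> nat -> D, (forall x, olt x b -> v x = 0) /\
    forall y, olt y g -> evz (ev (d 0 y) v - ev (e 1 y) c).

(** Deleting the variables below [b] from the rows removes the condition of vanishing below [b], and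
    the rows below [g] are countably many, as [solvable_pp] requires. *)
Lemma relative_solvable (B : lmodType R) (c : aleph1 -> B) :
  pp_closed (aleph1 + aleph1)%type D B ->
  (forall x, olt x b -> c x = 0) -> (forall z, olt z g -> ev (d 1 z) c = 0) ->
  exists v : aleph1 -> B, (forall x, olt x b -> v x = 0) /\
    forall y, olt y g -> ev (d 0 y) v = ev (e 1 y) c.
Proof.
move=> ppB cb0 dc; have [en enP] := olt_enum g.
pose sel (r : seq (R * aleph1)) := [seq p <- r | `[< ole b p.2 >]].
pose rw (r : aleph1 -> seq (R * aleph1)) i :=
  if pselect (olt (en i) g) then sel (r (en i)) else [::].
pose cut (C : lmodType R) (f : aleph1 -> C) x := if `[< ole b x >] then f x else 0.
have cut_lt (C : lmodType R) (f : aleph1 -> C) x : olt x b -> cut C f x = 0.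
  by move=> xb; rewrite /cut; case: asboolP.
have cut_id (C : lmodType R) (f : aleph1 -> C) : (forall x, olt x b -> f x = 0) -> cut C f = f.
  move=> f0; apply/funext => x; rewrite /cut; case: asboolP => // nbx.
  by rewrite f0 //; apply: contrapT => nxb; apply: nbx.
have sel_ev (C : lmodType R) r (f : aleph1 -> C) : ev (sel r) f = ev r (cut C f).
  by rewrite /sel (ev_filter (fun x => `[< ole b x >])).
have rwP (r : aleph1 -> seq (R * aleph1)) (P : seq (R * aleph1) -> Prop) :
    (forall i, P (rw r i)) -> forall y, olt y g -> P (sel (r y)).
  by move=> h y yg; have [i iy] := enP y yg; have := h i; rewrite /rw iy; case: pselect.
have [|||v vP] := @solvable_pp R aleph1 (rw (d 0)) (rw (d 1)) (rw (e 1)) D _ _ B ppB c.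
- move=> v vfin; have [||u [u1 u2 u3]] := @relative_fin (cut _ v).
  + by move=> x; exact: cut_lt.
  + by move=> y yg; rewrite -sel_ev; exact: (rwP (d 0) (fun r => evz (ev r v))).
  exists u => // i; rewrite /rw; case: pselect => [eg|neg]; last by rewrite !ev_nil.
  by rewrite !sel_ev (cut_id _ u) // u3.
- move=> c' cfin; have [||v [v1 v2]] := @relative_mod_fin (cut _ c').
  + by move=> x; exact: cut_lt.
  + by move=> y yg; rewrite -sel_ev; exact: (rwP (d 1) (fun r => evz (ev r c'))).
  exists v => i; rewrite /rw; case: pselect => [eg|neg].
    by rewrite !sel_ev (cut_id _ v) //; exact: v2.
  by rewrite !ev_nil subrr; exists 0%N.
- move=> i; rewrite /rw; case: pselect => [eg|neg]; last by rewrite ev_nil.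
  by rewrite sel_ev cut_id // dc.
exists (cut _ v); split=> [x|y yg]; first exact: cut_lt.
have [i iy] := enP y yg; have := vP i; rewrite /rw; case: pselect => [ig|]; last by rewrite iy.
by rewrite !sel_ev iy (cut_id _ c).
Qed.

End Relative.

(** A cochain on a closed segment that is a cocycle modulo finite sequences extends to one on all of
    [aleph1], where the vanishing results apply; the outcome is restricted to the segment. *)
Lemma absolute_solvable : exists psi, forall g, oclosed psi g ->
  (forall v : aleph1 -> nat -> D, (forall y, olt y g -> evz (ev (d 0 y) v)) ->
     exists2 u : aleph1 -> nat -> D, (forall x, evz (u x)) &
       forall y, olt y g -> ev (d 0 y) u = ev (d 0 y) v) /\
  (forall c : aleph1 -> nat -> D, (forall z, olt z g -> evz (ev (d 1 z) c)) ->
     exists v : aleph1 -> nat -> D, forall y, olt y g -> evz (ev (d 0 y) v - ev (e 1 y) c)).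
Proof.
have [phi phiP] := rows_bound.
have [psi0 psi0P] := extend_mod_fin 0; have [psi1 psi1P] := extend_mod_fin 1.
exists (fun x => omax (phi x) (omax (psi0 x) (psi1 x))).
move=> g /oclosed_max[cg /oclosed_max[cg0 cg1]].
have row n y x : olt y g -> x \in vars (d n y) ++ vars (e n y) -> olt x g.
  by move=> yg xy; apply: olt_trans (cg _ yg); exact: phiP xy.
(* An arbitrary coordinate: sequences become matrices with the single row [o]. *)
pose o := aleph1_inhabited.
split=> [v vP|c cP].
  have [w wv wP] := psi0P g cg0 v vP.
  have [||u um uP] := @van_matfin 0 (fun y => odelta o (ev (d 0 y) w)).
  - by move=> y; apply: matfin_delta.
  - by move=> z; rewrite odelta_ev dd; apply/funext => a; rewrite /odelta; case: eqP.
  exists (fun x => u x o) => [x|y yg]; first exact: matfin_coord.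
  rewrite -ev_fun -uP ev_fun /odelta eqxx ed.
  by apply: eq_ev => x xy; apply: wv; apply: (row 0%N y) => //; rewrite mem_cat xy.
have [w wc wP] := psi1P g cg1 c cP.
have [||h hc hP] := @van_mod_matfin 0 (fun y => odelta o (w y)).
- by move=> y; exact: colfin_delta.
- by move=> z; rewrite odelta_ev; exact: matfin_delta.
exists (fun x => h x o) => y yg.
have := submod_predN (@evz_submod R D) (matfin_coord o (hP y)); congr evz.
rewrite -[LHS]/(- (ev (e 1 y) (fun y => odelta o (w y)) o - ev (d 0 y) h o)) opprB !ev_fun.
congr (_ - _); rewrite /odelta eqxx; apply: eq_ev => x xy; apply: wc.
by apply: (row 1%N y) => //; rewrite mem_cat xy orbT.
Qed.

Lemma absolute_solvable_pp : exists psi, forall g, oclosed psi g ->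
  forall (B : lmodType R) (c : aleph1 -> B), pp_closed (aleph1 + aleph1)%type D B ->
  (forall z, olt z g -> ev (d 1 z) c = 0) ->
  exists v : aleph1 -> B, forall y, olt y g -> ev (d 0 y) v = ev (e 1 y) c.
Proof.
have [psi psiP] := absolute_solvable; exists psi => g cg B c ppB dc.
have [fin_g mod_g] := psiP g cg.
(* With the least element for [b], vanishing below [b] is no condition. *)
have [o _ oP] := @omin setT (ex_intro _ aleph1_inhabited I).
have noo x : ~ olt x o by exact: oP.
have [||||v [_ vP]] := @relative_solvable o g _ _ B c ppB; last by exists v.
- by move=> v _ vP; have [u u1 u2] := fin_g v vP; exists u; split=> // x /noo.
- by move=> c' _ cP; have [v vP] := mod_g c' cP; exists v; split=> // x /noo.
- by move=> x /noo.
- exact: dc.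
Qed.

(** Again [extend_cocycle], now with finite matrices and with zero as the only negligible element.
    In place of saturation, [absolute_solvable_pp] for a direct sum of copies of [D] solves the
    equations on a closed segment. *)
Lemma extend_fin : exists psi, forall b, oclosed psi b ->
  forall c : aleph1 -> nat -> D, (forall x, evz (c x)) ->
  (forall y, olt y b -> ev (d 0 y) c = 0) ->
  exists c' : aleph1 -> nat -> D, [/\ forall x, evz (c' x), forall x, olt x b -> c' x = c x &
    forall y, ev (d 0 y) c' = 0].
Proof.
have [phi phiP] := rows_bound; have [psi psiP] := absolute_solvable_pp.
have z_submod (B : lmodType R) : submod_pred (fun x : B => x = 0).
  by split=> // a x y -> ->; rewrite scaler0 addr0.
pose phi0 x := omax (phi x) (psi x).
have le0 x y : olt x (phi y) -> olt x (phi0 y).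
  by move=> xy; apply: olt_le_trans xy _; exact: omaxl.
apply: (@extend_cocycle R (nat -> D) (d 0) (d 1) (e 1)
  (@dd 0) (@ed 0) phi0 _ _ _ (@matfin R D) (fun t => t = 0) (@evz R D) (fun a => a = 0)
  (@matfin_submod R D) (z_submod _)).
- by move=> y x xy; apply/le0/(phiP 0%N); rewrite mem_cat xy.
- by move=> y x xy; apply/le0/(phiP 1%N); rewrite mem_cat xy.
- by move=> y x xy; apply/le0/(phiP 1%N); rewrite mem_cat xy orbT.
- exact: matfin_delta.
- by move=> a x ->; apply/funext => b; rewrite /odelta; case: eqP.
- exact: matfin_coord.
- by move=> a t ->.
- exact: matfin_trunc.
- by move=> b t ->; apply/funext => a; rewrite /otrunc; case: pselect.
- by move=> t [tc _]; exact: colfin_bounded.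
- move=> b t /oclosed_max[cb cbpsi] tm loc.
  have row n y x : olt y b -> x \in vars (d n y) ++ vars (e n y) -> olt x b.
    by move=> yb xy; apply: olt_trans (cb _ yb); exact: phiP xy.
  (* A row involves finitely many values of [t], and there [t] is a coboundary; so identities
     satisfied by coboundaries, row by row, hold for [t] below [b]. *)
  have tP (r : seq (R * aleph1)) : (forall x, x \in vars r -> olt x b) -> forall ys : seq aleph1,
      (forall y, y \in ys -> olt y b) ->
      exists s : aleph1 -> T, ev r (fun y => ev (d 0 y) s) = ev r t /\
        forall y, y \in ys -> ev (d 0 y) s = t y.
    move=> rb ys ysb; have [|s _ sP] := loc (vars r ++ ys).
      by move=> y; rewrite mem_cat => /orP[/rb|/ysb].
    have sE y : y \in vars r ++ ys -> ev (d 0 y) s = t y.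
      by move=> /sP/eqP; rewrite subr_eq0 => /eqP.
    exists s; split=> [|y yys]; last by rewrite sE // mem_cat yys orbT.
    by apply: eq_ev => y yr; rewrite sE // mem_cat yr.
  have dt z : olt z b -> ev (d 1 z) t = 0.
    move=> zb; have [x xz||s [<- _]] := tP (d 1 z) _ [::] _; last exact: dd.
      by apply: (row 1%N z) => //; rewrite mem_cat xz.
    by [].
  have et y : olt y b -> ev (e 1 y) t = t y.
    move=> yb; have [x xy|z|s [<- sP]] := tP (e 1 y) _ [:: y] _.
    - by apply: (row 1%N y) => //; rewrite mem_cat xy orbT.
    - by rewrite inE => /eqP->.
    by rewrite ed sP // inE.
  have tfin y : (fun p : aleph1 * nat => t y p.1 p.2) \in @finsupp_pred R (aleph1 * nat)%type D.
    by apply/asboolP/matfinP.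
  have [||v vP] := psiP b cbpsi (direct_sum (aleph1 * nat)%type D) (fun y => DirectSum (tfin y)).
  + exact: pp_closed_direct_sum.
  + move=> z zb; apply: val_inj; apply/funext => -[a k] /=; rewrite dsum_ev /=.
    by have := congr1 (fun t => t a k) (dt z zb); rewrite !ev_fun.
  exists (fun x a k => v x (a, k)) => [x|y yb].
    by apply/matfinP; have /asboolP := dsum_valP (v x); apply: sub_finite_set => -[a k].
  apply/eqP; rewrite subr_eq0 -et //; apply/eqP/funext => a; apply/funext => k.
  by rewrite !ev_fun -(dsum_ev (d 0 y) v) vP // dsum_ev.
- move=> t tm dt; have [h hm hP] := van_matfin tm dt.
  by exists h => // y; rewrite hP subrr.
Qed.

(** A primitive is continued from one closure point to a larger one: its error is a cocycle
    vanishing below the first, and [rel] gives a correction that changes no earlier value. *)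
Theorem closure_solvable (B : lmodType R) (c : aleph1 -> B) :
  pp_closed (aleph1 + aleph1)%type D B ->
  (forall z, ev (d 1 z) c = 0) ->
  exists v : aleph1 -> B, forall y, ev (d 0 y) v = ev (e 1 y) c.
Proof.
move=> ppB dc; have [phi phiP] := rows_bound.
have [psi0 psi0P] := extend_mod_fin 0; have [psi1 psi1P] := absolute_solvable.
have [psi2 psi2P] := extend_fin.
pose psi x := omax (omax (phi x) (psi0 x)) (omax (psi1 x) (psi2 x)).
have psiE b : oclosed psi b -> [/\ oclosed phi b, oclosed psi0 b, oclosed psi1 b & oclosed psi2 b].
  by move=> /oclosed_max[/oclosed_max[? ?] /oclosed_max[? ?]].
have row n b y x : oclosed psi b -> olt y b -> x \in vars (d n y) ++ vars (e n y) -> olt x b.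
  by move=> /psiE[cb _ _ _] yb xy; apply: olt_trans (cb _ yb); exact: phiP xy.
have [o _ oP] := @omin setT (ex_intro _ aleph1_inhabited I).
have rel b g (c' : aleph1 -> B) : oclosed psi b -> oclosed psi g -> olt b g ->
    (forall x, olt x b -> c' x = 0) -> (forall z, olt z g -> ev (d 1 z) c' = 0) ->
    exists v : aleph1 -> B, (forall x, olt x b -> v x = 0) /\
      forall y, olt y g -> ev (d 0 y) v = ev (e 1 y) c'.
  move=> cb cg bg; have [_ cb0 _ cb2] := psiE b cb; have [_ _ cg1 _] := psiE g cg.
  have [fin_g mod_g] := psi1P g cg1.
  apply: relative_solvable ppB => [v vb vP|c1 c1b c1P].
    (* Below [b] the finite solution [u0] is a cocycle, since [v] vanishes there; subtracting a
       finite global cocycle that extends it leaves a solution vanishing below [b]. *)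
    have [u0 u0z u0P] := fin_g v vP.
    have [|y yb|u1 [u1z u1b u1P]] := psi2P b cb2 u0; first exact: u0z.
      rewrite u0P; last exact: olt_trans bg.
      by apply: ev_eq0 => x xy; apply: vb; apply: (row 0%N b y) => //; rewrite mem_cat xy.
    exists (fun x => u0 x - u1 x); split=> [x|x xb|y yg].
    - exact: (submod_predB (@evz_submod R D)).
    - by rewrite u1b // subrr.
    - by rewrite evB u1P subr0 u0P.
  (* The same correction modulo finite sequences: the rows of [e 1] below [b] kill [c1], so [v0] is
     a cocycle there. *)
  have [v0 v0P] := mod_g c1 c1P.
  have [y yb|v1 v1b v1P] := psi0P b cb0 v0.
    have := v0P y (olt_trans yb bg); rewrite (@ev_eq0 _ _ _ (e 1 y)) ?subr0 //.
    by move=> x xy; apply: c1b; apply: (row 1%N b y) => //; rewrite mem_cat xy orbT.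
  exists (fun x => v0 x - v1 x); split=> [x xb|y yg]; first by rewrite v1b // subrr.
  rewrite evB addrAC; apply: (submod_predB (@evz_submod R D)) => //; exact: v0P.
have noo x : ~ olt x o by exact: oP.
have oo : oclosed psi o by move=> x /noo.
have [|||v _ vP] := @transfinite_extension B psi
  (fun v y => ev (d 0 y) v = ev (e 1 y) c) _ _ o (fun=> 0) oo; last by exists v.
- move=> b f g cb fg fP y yb; rewrite -fP //; apply: eq_ev => x xy.
  by rewrite fg //; apply: (row 0%N b y) => //; rewrite mem_cat xy.
- move=> b g f cb cg bg fP.
  pose f0 x := if pselect (olt x b) then f x else 0.
  (* The remaining error vanishes below [b], where [f] is a primitive; it is a cocycle, and [e 1]
     fixes it. *)
  pose c' y := ev (e 1 y) c - ev (d 0 y) f0.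
  have [y yb|z zg|w [wb wP]] := rel b g c' cb cg bg.
  + rewrite /c' -(fP y yb) -evB; apply: ev_eq0 => x xy; rewrite /f0; case: pselect => [xb|].
      by rewrite subrr.
    by case; apply: (row 0%N b y) => //; rewrite mem_cat xy.
  + by rewrite /c' evB de dd dc subr0.
  exists (fun x => f0 x + w x) => [x xb|y yg].
    by rewrite wb // addr0 /f0; case: pselect.
  by rewrite evD wP // /c' evB ee ed addrC subrK.
- by move=> y /noo.
Qed.

End Vanishing.

(** * Dual bases of projective modules *)

Section DualBasis.
Variables (R : pzRingType) (I : choiceType).
Local Notation F := (direct_sum I R^o).

Let supp_ex (a : F) : exists s : seq I, uniq s /\ forall i, a i <> 0 -> i \in s.
Proof.
have /asboolP/finite_seqP[s sP] := dsum_valP a.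
exists (undup s); split=> [|i ai]; first exact: undup_uniq.
by rewrite mem_undup; have : [set` s] i by rewrite -sP.
Qed.

Let supp (a : F) := sval (cid (supp_ex a)).

Let supp_uniq (a : F) : uniq (supp a). Proof. by have [] := svalP (cid (supp_ex a)). Qed.

Let suppP (a : F) i : a i <> 0 -> i \in supp a.
Proof. by have [_] := svalP (cid (supp_ex a)); apply. Qed.

Let comb (B : lmodType R) (f : I -> B) (a : F) : B := \sum_(i <- supp a) (a i : R) *: f i.

Let combE (B : lmodType R) (f : I -> B) (a : F) (s : seq I) : uniq s ->
  (forall i, a i <> 0 -> i \in s) -> comb f a = \sum_(i <- s) (a i : R) *: f i.
Proof.
move=> us sP; pose Q : pred I := fun i => `[< a i <> 0 >].
have restr (t : seq I) :
    \sum_(i <- t) (a i : R) *: f i = \sum_(i <- [seq i <- t | Q i]) (a i : R) *: f i.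
  rewrite big_filter [RHS]big_mkcond; apply: eq_bigr => i _.
  by rewrite /Q; case: asboolP => // /contrapT ->; rewrite scale0r.
rewrite /comb restr [RHS]restr; apply: perm_big; apply: uniq_perm.
- exact/filter_uniq/supp_uniq.
- exact: filter_uniq.
move=> i; rewrite !mem_filter /Q; case: asboolP => //= ai.
by rewrite suppP // sP.
Qed.

Let comb_linear (B : lmodType R) (f : I -> B) : linear (comb f).
Proof.
move=> c a b; pose s := undup (supp a ++ supp b).
have us : uniq s by exact: undup_uniq.
have sa i : a i <> 0 -> i \in s by move=> /suppP ai; rewrite mem_undup mem_cat ai.
have sb i : b i <> 0 -> i \in s by move=> /suppP bi; rewrite mem_undup mem_cat bi orbT.
rewrite (combE f us) ?(combE f us sa) ?(combE f us sb) ?scaler_sumr -?big_split /=.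
  by apply: eq_bigr => i _; rewrite scalerDl scalerA.
move=> i ci; have [ai0|ai] := pselect (a i = 0); last exact: sa.
apply: sb => bi; apply: ci.
by rewrite -[LHS]/(c * (a i : R) + b i) ai0 bi mulr0 addr0.
Qed.

(** A section [h] of the free cover gives coordinates that are linear in [x]; hence the linearity
    for every family [f], even one violating the relations among the generators. *)
Lemma dual_basis (P : lmodType R) (gen : I -> P) : projective P ->
  (forall x, exists s, ev s gen = x) ->
  exists rw : P -> seq (R * I), (forall x, ev (rw x) gen = x) /\
    forall (B : lmodType R) (f : I -> B), linear (fun x => ev (rw x) f).
Proof.
move=> projP genP.
pose g : {linear F -> P} := HB.pack (comb gen)
  (GRing.isLinear.Build R F P *:%R (comb gen) (comb_linear gen)).
have dfin i : (fun j => if j == i then 1 else 0 : R^o) \in @finsupp_pred R I R^o.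
  apply/asboolP; apply: (sub_finite_set _ (finite_set1 i)) => j /=.
  by case: eqP.
pose delta i : F := DirectSum (dfin i).
have g_delta i : g (delta i) = gen i.
  rewrite -[LHS]/(comb gen (delta i)) (combE gen (s := [:: i])) //.
    by rewrite big_seq1 /= eqxx scale1r.
  by move=> j /=; rewrite inE; case: eqP.
have [|h hP] := projP F P g (idfun : {linear P -> P}).
  move=> x; have [s <-] := genP x; exists (ev s delta).
  by rewrite linear_ev; apply: eq_ev => i _; exact: g_delta.
pose rw x := [seq ((h x i : R), i) | i <- supp (h x)].
have rwE (B : lmodType R) (f : I -> B) x : ev (rw x) f = comb f (h x).
  by rewrite /ev /rw big_map.
exists rw; split=> [x|B f c x y]; first by rewrite rwE; exact: hP.
by rewrite !rwE linearP; exact: comb_linear.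
Qed.

End DualBasis.

(** Here [g] need not be surjective. With all elements of [P] as generators, the dual basis turns an
    arbitrary choice [k] of preimages into a linear map. *)
Lemma projective_lift (R : pzRingType) (P A C : lmodType R) (g : {linear A -> C})
    (f : {linear P -> C}) : projective P -> (forall x, exists a, g a = f x) ->
  exists h : {linear P -> A}, forall x, g (h x) = f x.
Proof.
move=> projP gf.
have [|rw [rwP rwL]] := @dual_basis R P P id projP.
  by move=> x; exists [:: (1, x)]; rewrite /ev big_seq1 scale1r.
have /choice[k kP] := gf.
pose h : {linear P -> A} := HB.pack (fun x => ev (rw x) k)
  (GRing.isLinear.Build R P A *:%R (fun x => ev (rw x) k) (rwL A k)).
exists h => x; rewrite -[h x]/(ev (rw x) k) linear_ev -[in RHS](rwP x) linear_ev.
by apply: eq_ev => y _; exact: kP.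
Qed.

Lemma aleph1_generated_family (R : pzRingType) (M : lmodType R) : aleph1_generated M ->
  exists gen : aleph1 -> M, forall x, exists s, ev s gen = x.
Proof.
move=> [S [cS genS]].
pose W : choiceType := aleph1.
pose aleph1P : pointedType := HB.pack W (isPointed.Build W aleph1_inhabited).
have /(@pcard_injP _ aleph1P)[f finj] := cS.
pose gen c := if pselect (exists2 x, S x & f x = c) is left e then s2val (cid2 e) else 0.
have genf x : S x -> gen (f x) = x.
  move=> Sx; rewrite /gen; case: pselect => [e|[]]; last by exists x.
  by case: cid2 => y Sy /= fyx; apply: finj; rewrite ?inE.
exists gen => x; have [s [sS ->]] := genS x; exists [seq (p.1, f p.2) | p <- s].
rewrite /ev big_map [LHS]big_seq [RHS]big_seq; apply: eq_bigr => p ps /=.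
by rewrite genf //; exact: sS.
Qed.

(** * Independence of the resolution *)

Section Comparison.
Variables (R : pzRingType) (M B : lmodType R) (P Q : projective_resolution M).
Hypothesis van : forall f : {linear P 1 -> B}, cocycle f -> coboundary f.

(** The comparison argument: lifts of the identity of [M] to maps between [P] and [Q], and a
    homotopy [h] in degree 0, carry the vanishing from [P] to [Q]. *)
Lemma cocycle1_coboundary (f : {linear Q 1 -> B}) : cocycle f -> coboundary f.
Proof.
move=> f0.
have lift0 (P1 P2 : projective_resolution M) : exists h : {linear P1 0 -> P2 0},
    forall x, res_aug P2 (h x) = res_aug P1 x.
  apply: projective_lift => [|x]; first exact: res_projective.
  exact: res_aug_surj.
have res_dd (P1 : projective_resolution M) n x : res_d P1 n (res_d P1 n.+1 x) = 0.
  by apply/res_exact; exists x.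
have res_augd (P1 : projective_resolution M) x : res_aug P1 (res_d P1 0 x) = 0.
  by apply/res_exact0; exists x.
have lift1 (P1 P2 : projective_resolution M) (h : {linear P1 0 -> P2 0}) :
    (forall x, res_aug P2 (h x) = res_aug P1 x) ->
    exists k : {linear P1 1 -> P2 1}, forall x, res_d P2 0 (k x) = h (res_d P1 0 x).
  move=> hP; apply: (@projective_lift R _ _ _ (res_d P2 0) (h \o res_d P1 0)).
    exact: res_projective.
  by move=> x; apply/res_exact0; rewrite /= hP res_augd.
have [phi0 phi0P] := lift0 Q P; have [psi0 psi0P] := lift0 P Q.
have [phi1 phi1P] := lift1 Q P phi0 phi0P; have [psi1 psi1P] := lift1 P Q psi0 psi0P.
(* Hence equalities between values of [f] may be checked after [res_d Q 0], so the homotopy in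
   degree 0 suffices. *)
have fker x : res_d Q 0 x = 0 -> f x = 0 by move=> /res_exact[y <-]; exact: f0.
have [h hP] : exists h : {linear Q 0 -> Q 1}, forall x, res_d Q 0 (h x) = psi0 (phi0 x) - x.
  apply: (@projective_lift R _ _ _ (res_d Q 0) ((psi0 \o phi0) \- idfun)).
    exact: res_projective.
  by move=> x; apply/res_exact0; rewrite /= linearB psi0P phi0P subrr.
have [|g gP] := van (f := f \o psi1).
  by move=> x; apply: fker; rewrite psi1P res_dd linear0.
exists ((g \o phi0) \- (f \o h)) => x /=.
rewrite -phi1P -gP /= -linearB; apply/eqP; rewrite -subr_eq0 -linearB; apply/eqP/fker.
by rewrite linearB [X in _ - X]linearB hP psi1P phi1P subKr subrr.
Qed.

End Comparison.

(** * Passage from a resolution to its matrices *)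

Theorem proposition1p12 (R : pzRingType) (D M : lmodType R)
    (hM : strongly_aleph1_presented M)
    (hExt : forall n : nat, (1 <= n)%N -> Ext_eq0 n M (direct_sum aleph1 D)) :
  left_perp (definable_closure D) M.
Proof.
move=> B BD Q; have [P Pgen] := hM; apply: (@cocycle1_coboundary R M B P Q) => f f0.
have gen_ex n := aleph1_generated_family (Pgen n).
pose gen n := sval (cid (gen_ex n)).
have genP n x : exists s, ev s (gen n) = x := svalP (cid (gen_ex n)) x.
have rw_ex n := dual_basis (@res_projective R M P n) (genP n).
pose rw n := sval (cid (rw_ex n)).
have rwP n x : ev (rw n x) (gen n) = x by have [h _] := svalP (cid (rw_ex n)); exact: h.
have rwL n (C : lmodType R) (c : aleph1 -> C) : linear (fun x => ev (rw n x) c).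
  by have [_] := svalP (cid (rw_ex n)); apply.
pose lift n (C : lmodType R) (c : aleph1 -> C) : {linear P n -> C} :=
  HB.pack (fun x => ev (rw n x) c)
  (GRing.isLinear.Build R (P n) C *:%R (fun x => ev (rw n x) c) (rwL n C c)).
pose d n y := rw n (res_d P n (gen n.+1 y)).
pose e n y := rw n (gen n y).
have rw_gen n (C : lmodType R) (h : {linear P n -> C}) x :
    ev (rw n x) (fun y => h (gen n y)) = h x.
  by rewrite -linear_ev rwP.
have lin_gen n (C : lmodType R) (h k : {linear P n -> C}) :
    (forall y, h (gen n y) = k (gen n y)) -> forall x, h x = k x.
  by move=> hk x; have [s <-] := genP n x; rewrite !linear_ev; apply: eq_ev.
have res_dd n x : res_d P n (res_d P n.+1 x) = 0 by apply/res_exact; exists x.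
have dd n (C : lmodType R) (c : aleph1 -> C) z : ev (d n.+1 z) (fun y => ev (d n y) c) = 0.
  rewrite (rw_gen n.+1 C (lift n C c \o res_d P n)).
  rewrite -[LHS]/(lift n C c (res_d P n (res_d P n.+1 (gen n.+2 z)))).
  by rewrite res_dd linear0.
have ed n (C : lmodType R) (c : aleph1 -> C) z :
    ev (e n.+1 z) (fun y => ev (d n y) c) = ev (d n z) c.
  exact: (rw_gen n.+1 C (lift n C c \o res_d P n)).
have de n (C : lmodType R) (c : aleph1 -> C) z :
    ev (d n z) (fun y => ev (e n y) c) = ev (d n z) c.
  exact: (rw_gen n C (lift n C c)).
have ee n (C : lmodType R) (c : aleph1 -> C) z :
    ev (e n z) (fun y => ev (e n y) c) = ev (e n z) c.
  exact: (rw_gen n C (lift n C c)).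
have van n (c : aleph1 -> direct_sum aleph1 D) : (forall z, ev (d n.+1 z) c = 0) ->
    exists g : aleph1 -> direct_sum aleph1 D, forall y, ev (e n.+1 y) c = ev (d n y) g.
  move=> c0; have [|g gP] := hExt n.+1 isT P (lift n.+1 _ c).
    by move=> x; apply: (lin_gen n.+2 _ (lift n.+1 _ c \o res_d P n.+1) \0%R).
  exists (fun x => g (gen n x)) => y; rewrite rw_gen; exact: gP.
(* The values of [f] on the generators are fixed by [e 1], so the primitive obtained for their image
   is one for [f]. *)
have [||v vP] := closure_solvable dd ed de ee van (c := fun y => f (gen 1 y)) (B := B).
- exact: definable_closure_pp.
- by move=> z; rewrite rw_gen f0.
exists (lift 0 B v) => x.
by apply: (lin_gen 1%N B f (lift 0 B v \o res_d P 0)) => y; rewrite /= [RHS]vP rw_gen.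
Qed.
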